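(* Let $G$ be a direct limit of Polish groups, $K\subset G$ a compact subgroup, and let $\tau=\mathcal{R}es_{G/\!\!/K}(\rho)$, where $\rho$ is a unitary representation of $G$ whose subspace of $K$-fixed vectors is cyclic; let $V$ be the space of $\tau$. Then for all finite sums $\sum_i v_i\delta_{a_i}\in\Delta(K\setminus G,\tau)$ (with $v_i\in V$, $a_i\in K\setminus G$) we have $$\sum_{i,j}\langle\mathcal{L}(a_i,a_j)v_i,v_j\rangle_V\ge0,$$ and the representation of $G$ in the Hilbert space $\overline{\Delta(K\setminus G,\tau)}$ is equivalent to $\rho$.
   Context: Hilbert spaces are separable; unitary representations are (strongly) continuous. A Polish group is a topological group whose topology is Polish. A direct limit of Polish groups is $G=\bigcup_j G_j$ for a sequence $G_1\subset G_2\subset\cdots$ of Polish groups (each a topological subgroup of the next), where $U\subset G$ is open iff all $U\cap G_j$ are open in $G_j$. Every compact subset of $G$ lies in some $G_j$. $\mathcal{M}(G)$ is the algebra of finite compactly supported complex-valued Borel measures on $G$ with convolution ($\mu_1*\mu_2$ is the pushforward of $\mu_1\times\mu_2$ under $(g_1,g_2)\mapsto g_1g_2$) and involution $\mu\mapsto\mu^\star$, the pushforward of $\overline\mu$ under $g\mapsto g^{-1}$. $\mathcal{M}(G/\!\!/K)$ is the $*$-subalgebra of measures invariant under left and right shifts by elements of $K$. $\delta_K$ is the probability Haar measure on $K$ regarded as an element of $\mathcal{M}(G)$; an element $g\in G$ is identified with the unit point mass at $g$. For a unitary representation $\rho$ of $G$ in $H$ put $\rho(\mu)=\int_G\rho(g)\,d\mu(g)$.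 Let $H^K$ be the subspace of $K$-fixed vectors; it is cyclic if the linear combinations of vectors $\rho(g)\eta$, $g\in G$, $\eta\in H^K$, are dense in $H$. For $\nu\in\mathcal{M}(G/\!\!/K)$ the operator $\rho(\nu)$ preserves $H^K$ and vanishes on $(H^K)^\perp$; $\mathcal{R}es_{G/\!\!/K}(\rho)$ is the $*$-representation $\nu\mapsto\rho(\nu)|_{H^K}$ of $\mathcal{M}(G/\!\!/K)$ in $H^K$. Let $z_0=K\cdot1$ be the base point of $K\setminus G$. For a $*$-representation $\tau$ of $\mathcal{M}(G/\!\!/K)$ in $V$, define the operator-valued kernel on $(K\setminus G)\times(K\setminus G)$ by $$\mathcal{L}(x,y)=\tau(\delta_K*hg^{-1}*\delta_K),\qquad z_0g=x,\ z_0h=y$$ (independent of the choice of $g,h$). It satisfies $\mathcal{L}(xr,yr)=\mathcal{L}(x,y)$ for $r\in G$. $\Delta(K\setminus G,\tau)$ is the space of finitely supported functions $K\setminus G\to V$; $v\delta_z$ is the function equal to $v$ at $z$ and $0$ elsewhere. Define the sesquilinear form $$\Bigl\langle\sum_i v_i\delta_{a_i},\sum_j w_j\delta_{b_j}\Bigr\rangle=\sum_{i,j}\langle\mathcal{L}(a_i,b_j)v_i,w_j\rangle_V.$$ When it is nonnegative, $\overline{\Delta(K\setminus G,\tau)}$ is the associated Hilbert space (quotient by null vectors, then completion). $G$ acts in $\Delta(K\setminus G,\tau)$ by shifts of the argument, $(r\cdot f)(x)=f(xr)$, and this induces unitary operators in $\overline{\Delta(K\setminus G,\tau)}$. *)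

(* Defs.v *)
From HB Require Import structures.
From mathcomp Require Import all_boot all_order all_algebra generic_quotient sesquilinear.
From mathcomp Require Import complex.
From mathcomp Require Import all_classical all_reals all_analysis.

Set Implicit Arguments.
Unset Strict Implicit.
Unset Printing Implicit Defensive.

Import Order.TTheory GRing.Theory Num.Theory.
Import numFieldNormedType.Exports.
Local Open Scope classical_set_scope.
Local Open Scope ring_scope.

(* Hermitian forms are linear in the first and conjugate-linear in the second
   argument. *)
Record nonneg_form (C : numClosedFieldType) (D : lmodType C) := NonnegForm {
  form_of :> {hermitian_sym D for Num.conj};
  form_ge0 : forall u, 0 <= form_of u u }.

Section nonneg_form_theory.
Variables (C : numClosedFieldType) (D : lmodType C) (B : nonneg_form D).
Implicit Types u v w : D.

Definition form_norm u : C := sqrtC (B u u).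

Lemma formC u v : B u v = (B v u)^*.
Proof. by rewrite [LHS](@hermitian_subproof _ _ _ _ B) expr0 mul1r. Qed.
Lemma formDl u v w : B (u + v) w = B u w + B v w.
Proof. exact: linearDl. Qed.
Lemma formZl c u w : B (c *: u) w = c * B u w.
Proof. exact: linearZl_LR. Qed.
Lemma formDr w u v : B w (u + v) = B w u + B w v.
Proof. exact: linearDr. Qed.
Lemma formZr w c u : B w (c *: u) = c^* * B w u.
Proof. by rewrite formC formZl rmorphM /= [in RHS]formC. Qed.
Lemma formNl u w : B (- u) w = - B u w.
Proof. by rewrite -scaleN1r formZl mulN1r. Qed.
Lemma formNr u w : B u (- w) = - B u w.
Proof. by rewrite -scaleN1r formZr rmorphN rmorph1 mulN1r. Qed.

Lemma form0l w : B 0 w = 0.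
Proof. exact: linear0l. Qed.

Lemma form_expand u v c : B (u - c *: v) (u - c *: v)
  = B u u - c^* * B u v - c * (B u v)^* + `|c| ^+ 2 * B v v.
Proof.
rewrite formDl !formDr !formNl !formNr !formZl !formZr (formC v u) normCK.
by rewrite opprK mulrA !addrA.
Qed.

Lemma form_CauchySchwarz u v : `|B u v| ^+ 2 <= B u u * B v v.
Proof.
have [v0|v0] := eqVneq (B v v) 0.
  rewrite v0 mulr0.
  have [->|uv0] := eqVneq (B u v) 0; first by rewrite normr0 expr0n.
  have n0 : `|B u v| ^+ 2 != 0 by rewrite expf_neq0 // normr_eq0.
  set r := (B u u + 1) / `|B u v| ^+ 2.
  have rR : r^* = r.
    apply: conj_Creal; rewrite ger0_real // mulr_ge0 ?invr_ge0 ?exprn_ge0 //.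
    by rewrite addr_ge0 ?form_ge0.
  have := form_ge0 B (u - (r * B u v) *: v).
  have e1 : (r * B u v)^* * B u v = B u u + 1.
    by rewrite rmorphM /= rR -mulrA -normCKC mulfVK.
  have e2 : (r * B u v) * (B u v)^* = B u u + 1.
    by rewrite -mulrA -normCK mulfVK.
  rewrite form_expand v0 mulr0 addr0 e1 e2.
  have -> : B u u - (B u u + 1) = -1 by rewrite opprD addrA subrr add0r.
  rewrite -opprD oppr_ge0 => h.
  have : 0 < 1 + (B u u + 1) by rewrite ltr_wpDr ?addr_ge0 ?form_ge0.
  by move=> /lt_le_trans /(_ h); rewrite ltxx.
have v_gt0 : 0 < B v v by rewrite lt_def v0 form_ge0.
have vR : ((B v v)^-1)^* = (B v v)^-1.
  by apply: conj_Creal; rewrite ger0_real // invr_ge0 form_ge0.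
have := form_ge0 B (u - (B u v / B v v) *: v).
set b := B u v; set a := (B v v)^-1.
have e1 : (b * a)^* * b = `|b| ^+ 2 * a.
  by rewrite rmorphM /= vR -/a mulrAC -normCKC.
have e2 : (b * a) * b^* = `|b| ^+ 2 * a by rewrite mulrAC -normCK.
have e3 : `|b * a| ^+ 2 * B v v = `|b| ^+ 2 * a.
  rewrite normrM exprMn -mulrA; congr (_ * _).
  by rewrite ger0_norm ?invr_ge0 ?form_ge0 // expr2 -mulrA mulVf // mulr1.
by rewrite form_expand -/b e1 e2 e3 subrK subr_ge0 ler_pdivrMr.
Qed.

Lemma form_norm_ge0 u : 0 <= form_norm u.
Proof. by rewrite sqrtC_ge0 form_ge0. Qed.

Lemma form_norm_sq u : form_norm u ^+ 2 = B u u.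
Proof. by rewrite sqrtCK. Qed.

Lemma form_norm_CS u v : `|B u v| <= form_norm u * form_norm v.
Proof.
rewrite -(@ler_pXn2r _ 2) ?nnegrE ?normr_ge0 ?mulr_ge0 ?form_norm_ge0 //.
by rewrite exprMn !form_norm_sq form_CauchySchwarz.
Qed.

Lemma form_normD u v : form_norm (u + v) <= form_norm u + form_norm v.
Proof.
rewrite -(@ler_pXn2r _ 2) ?nnegrE ?addr_ge0 ?form_norm_ge0 //.
have h : B u v + (B u v)^* <= (form_norm u * form_norm v) *+ 2.
  have -> : B u v + (B u v)^* = 'Re (B u v) *+ 2.
    by rewrite ReE -[RHS]mulr_natr mulfVK ?pnatr_eq0.
  rewrite lerMn2r /=; apply: le_trans (form_norm_CS _ _).
  by rewrite leif_Re_Creal.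
rewrite form_norm_sq sqrrD !form_norm_sq formDl !formDr (formC v u).
by rewrite -!addrA lerD2l !addrA lerD2r.
Qed.

Lemma form_normZ c u : form_norm (c *: u) = `|c| * form_norm u.
Proof.
rewrite /form_norm formZl formZr mulrA -normCK sqrtCM ?nnegrE ?exprn_ge0 ?form_ge0//.
by rewrite sqrCK.
Qed.

End nonneg_form_theory.

HB.mixin Record Lmodule_hasInner (R : realType) V & GRing.Lmodule R[i] V := {
  inner_form : {dot V for Num.conj}
}.

#[short(type="innerType")]
HB.structure Definition InnerSpace (R : realType) :=
  {V of GRing.Lmodule R[i] V & Lmodule_hasInner R V}.

Definition inner (R : realType) (V : innerType R) (u v : V) : R[i] :=
  @inner_form R V u v.

HB.mixin Record Inner_isHilbert (R : realType) H
    & CompleteNormedModule R[i] H & InnerSpace R H := {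
  inner_norm : forall v : H, inner v v = `|v| ^+ 2
}.

#[short(type="hilbertType")]
HB.structure Definition Hilbert (R : realType) :=
  {H of CompleteNormedModule R[i] H & InnerSpace R H & Inner_isHilbert R H}.

(* Two vectors are identified when their difference is a null vector of B. *)
Section null_quotient.
Variables (C : numClosedFieldType) (D : lmodType C) (B : nonneg_form D).
Implicit Types u v w : D.

Definition null_eqv : rel D := fun u v => B (u - v) (u - v) == 0.

Lemma null_eqvP u v : reflect (forall w, B u w = B v w) (null_eqv u v).
Proof.
apply: (iffP eqP) => [uv0 w|uv]; last by rewrite formDl formNl uv subrr.
apply/eqP; rewrite -subr_eq0 -formNl -formDl -normr_eq0 -sqrf_eq0.
have := form_CauchySchwarz B (u - v) w; rewrite uv0 mul0r => h.
by rewrite eq_le h exprn_ge0.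
Qed.

Lemma null_eqv_refl : reflexive null_eqv.
Proof. by move=> u; apply/null_eqvP. Qed.
Lemma null_eqv_sym : symmetric null_eqv.
Proof. by move=> u v; apply/null_eqvP/null_eqvP => h w; rewrite h. Qed.
Lemma null_eqv_trans : transitive null_eqv.
Proof.
by move=> v u w /null_eqvP h /null_eqvP k; apply/null_eqvP => z; rewrite h k.
Qed.

Canonical null_equiv := EquivRel null_eqv null_eqv_refl null_eqv_sym null_eqv_trans.

Definition null_quotient := {eq_quot null_equiv}%qT.
HB.instance Definition _ := Choice.on null_quotient.
HB.instance Definition _ := Quotient.on null_quotient.
Definition null_proj (u : D) : null_quotient := (\pi u)%qT.

Lemma null_projP u v : reflect (null_proj u = null_proj v) (null_eqv u v).
Proof. exact: eqmodP. Qed.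
Let repr_eqv u : null_eqv (repr (null_proj u)) u.
Proof. by apply/null_projP; exact: reprK. Qed.
Lemma null_proj_ind (P : null_quotient -> Prop) :
  (forall u, P (null_proj u)) -> forall x, P x.
Proof. by move=> h x; rewrite -[x]reprK; exact: h. Qed.

Let qadd (x y : null_quotient) := null_proj (repr x + repr y).
Let qopp (x : null_quotient) := null_proj (- repr x).
Let qscale c (x : null_quotient) := null_proj (c *: repr x).
Let qform (x y : null_quotient) : C := B (repr x) (repr y).

Let qaddE u v : qadd (null_proj u) (null_proj v) = null_proj (u + v).
Proof.
apply/null_projP/null_eqvP => w; rewrite !formDl.
by have /null_eqvP -> := repr_eqv u; have /null_eqvP -> := repr_eqv v.
Qed.
Let qoppE u : qopp (null_proj u) = null_proj (- u).
Proof.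
apply/null_projP/null_eqvP => w; rewrite !formNl.
by have /null_eqvP -> := repr_eqv u.
Qed.
Let qscaleE c u : qscale c (null_proj u) = null_proj (c *: u).
Proof.
apply/null_projP/null_eqvP => w; rewrite !formZl.
by have /null_eqvP -> := repr_eqv u.
Qed.
Let qformE u v : qform (null_proj u) (null_proj v) = B u v.
Proof.
rewrite /qform; have /null_eqvP -> := repr_eqv u.
by rewrite formC; have /null_eqvP -> := repr_eqv v; rewrite -formC.
Qed.

Let qaddA : associative qadd.
Proof.
by elim/null_proj_ind=> x; elim/null_proj_ind=> y; elim/null_proj_ind=> z;
  rewrite !qaddE addrA.
Qed.
Let qaddC : commutative qadd.
Proof.
by elim/null_proj_ind=> x; elim/null_proj_ind=> y; rewrite !qaddE addrC.
Qed.
Let qadd0 : left_id (null_proj 0) qadd.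
Proof. by elim/null_proj_ind=> x; rewrite !qaddE add0r. Qed.
Let qaddN : left_inverse (null_proj 0) qopp qadd.
Proof. by elim/null_proj_ind=> x; rewrite qoppE qaddE addNr. Qed.
HB.instance Definition _ :=
  GRing.isZmodule.Build null_quotient qaddA qaddC qadd0 qaddN.

Let qscaleA a b x : qscale a (qscale b x) = qscale (a * b) x.
Proof. by elim/null_proj_ind: x => x; rewrite !qscaleE scalerA. Qed.
Let qscale1 : left_id 1 qscale.
Proof. by elim/null_proj_ind => x; rewrite !qscaleE scale1r. Qed.
Let qscaleDr : right_distributive qscale +%R.
Proof.
move=> a; elim/null_proj_ind => x; elim/null_proj_ind=> y.
by rewrite [_ + _]qaddE !qscaleE [RHS]qaddE scalerDr.
Qed.
Let qscaleDl x : {morph qscale^~ x : a b / a + b}.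
Proof.
by move=> a b; elim/null_proj_ind: x => x; rewrite !qscaleE [RHS]qaddE scalerDl.
Qed.
HB.instance Definition _ :=
  GRing.Zmodule_isLmodule.Build C null_quotient qscaleA qscale1 qscaleDr qscaleDl.

Lemma null_projD u v : null_proj (u + v) = null_proj u + null_proj v.
Proof. by rewrite [RHS]qaddE. Qed.
Lemma null_projZ c u : null_proj (c *: u) = c *: null_proj u.
Proof. by rewrite [RHS]qscaleE. Qed.
Fact null_proj_is_linear : linear null_proj.
Proof. by move=> c u v; rewrite null_projD null_projZ. Qed.
HB.instance Definition _ :=
  GRing.isLinear.Build C D null_quotient *:%R null_proj null_proj_is_linear.

Definition null_quotient_form (x y : null_quotient) : C := B (repr x) (repr y).

Lemma null_quotient_formE u v : null_quotient_form (null_proj u) (null_proj v) = B u v.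
Proof. exact: qformE. Qed.

Let nqf_bil : bilinear_for ( *%R ) (Num.conj \; *%R : GRing.Scale.law C C) null_quotient_form.
Proof.
split.
  elim/null_proj_ind => w c; elim/null_proj_ind => u; elim/null_proj_ind => v.
  by rewrite -linearP !null_quotient_formE formDl formZl.
elim/null_proj_ind => w c; elim/null_proj_ind => u; elim/null_proj_ind => v.
by rewrite -linearP !null_quotient_formE formDr formZr.
Qed.
HB.instance Definition _ := bilinear_isBilinear.Build C null_quotient null_quotient C
  ( *%R ) (Num.conj \; *%R) null_quotient_form nqf_bil.
Let nqf_herm x y : null_quotient_form x y
  = (-1) ^+ false * Num.conj (null_quotient_form y x).
Proof.
elim/null_proj_ind: x => u; elim/null_proj_ind: y => v.
by rewrite !null_quotient_formE expr0 mul1r -formC.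
Qed.
HB.instance Definition _ := isHermitianSesquilinear.Build C null_quotient false
  Num.conj null_quotient_form nqf_herm.
Let nqf_dot x : x != 0 -> 0 < null_quotient_form x x.
Proof.
elim/null_proj_ind: x => u u0; rewrite null_quotient_formE lt_def form_ge0 andbT.
apply: contraNneq u0 => uu0; apply/eqP.
rewrite -(linear0 null_proj); apply/null_projP.
by rewrite /null_eqv subr0 uu0.
Qed.
HB.instance Definition _ := isDotProduct.Build C null_quotient null_quotient_form nqf_dot.

End null_quotient.

HB.instance Definition _ (R : realType) (D : lmodType R[i]) (B : nonneg_form D) :=
  Lmodule_hasInner.Build R (null_quotient B) (@null_quotient_form _ _ B).

Section cauchy_sequences.
Variables (R : realType) (D : lmodType R[i]) (B : nonneg_form D).
Local Notation C := R[i].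
Local Notation p := (form_norm B).

Definition form_cauchy (u : nat -> D) := forall e : C, 0 < e ->
  exists N, forall m n, (N <= m)%N -> (N <= n)%N -> p (u m - u n) < e.

Definition cauchy_pred : {pred (nat -> D)} := fun u => `[< form_cauchy u >].

Let cauchy0 : form_cauchy 0.
Proof.
by move=> e e0; exists 0%N => m n _ _; rewrite subrr /form_norm form0l sqrtC0.
Qed.

Fact cauchy_submod : submod_closed cauchy_pred.
Proof.
split; first exact/asboolP.
move=> c u v /asboolP hu /asboolP hv; apply/asboolP => e e0.
have e20 : 0 < e / 2 by rewrite divr_gt0.
have c1 : 0 < `|c| + 1 by rewrite ltr_wpDl.
have [N hN] := hu (e / 2 / (`|c| + 1)) (divr_gt0 e20 c1).
have [M hM] := hv _ e20.
exists (maxn N M) => m n; rewrite !geq_max => /andP[m1 m2] /andP[n1 n2].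
have -> : (c *: u + v) m - (c *: u + v) n = c *: (u m - u n) + (v m - v n).
  by rewrite /= scalerBr addrACA -opprD.
apply: le_lt_trans (form_normD _ _ _) _; rewrite [ltRHS]splitr form_normZ.
apply: ler_ltD (hM _ _ m2 n2).
apply: le_trans (_ : (`|c| + 1) * p (u m - u n) <= _).
  by rewrite ler_wpM2r ?form_norm_ge0 // lerDl.
by rewrite mulrC -ler_pdivlMr // ltW // hN.
Qed.
HB.instance Definition _ :=
  GRing.isSubmodClosed.Build C (nat -> D) cauchy_pred cauchy_submod.

Record cauchy_seqs := CauchySeq {
  cauchy_val :> nat -> D;
  cauchy_valP : cauchy_val \in cauchy_pred }.
HB.instance Definition _ := [isSub for cauchy_val].
HB.instance Definition _ := [Choice of cauchy_seqs by <:].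
HB.instance Definition _ := [SubChoice_isSubLmodule of cauchy_seqs by <:].

Lemma cauchy_cvgC (s : nat -> C) :
  (forall e : C, 0 < e -> exists N, forall m n, (N <= m)%N -> (N <= n)%N ->
     `|s m - s n| < e) ->
  cvgn (s : nat -> C^o).
Proof.
move=> hs.
have aux (f : C -> R) : {morph f : x y / x - y} -> (forall z, (`|f z|%:C)%C <= `|z|) ->
    exists l : R, forall e : R, 0 < e -> exists N, forall n, (N <= n)%N ->
      `|f (s n) - l| < e.
  move=> fB fle.
  have : cvgn (f \o s).
    apply: cauchy_cvg; apply: cauchy_exP => e e0.
    have [|N hN] := hs e%:C%C; first by rewrite ltcR.
    exists (f (s N)); exists N => // n /= Nn; rewrite /ball /= -fB -ltcR.
    by apply: le_lt_trans (fle _) _; exact: hN.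
  move=> /cvg_ex[l /cvgrPdist_lt hl]; exists l => e e0.
  by have [N _ hN] := hl e e0; exists N => n Nn; rewrite distrC; apply: hN.
have [||a ha] := aux (@complex.Re R); first by case=> ? ? [].
  by move=> z; exact: normc_ge_Re.
have [||b hb] := aux (@complex.Im R); first by case=> ? ? [].
  by move=> z; rewrite normc_def lecR -sqrtr_sqr ler_wsqrtr // lerDr sqr_ge0.
apply/cvg_ex; exists (a +i* b)%C; apply/cvgrPdist_lt => e e0.
have [r [r0 ->]] : exists r : R, 0 < r /\ e = r%:C%C.
  by exists (complex.Re e); case: e e0 => x y; rewrite ltcE /= => /andP[/eqP-> ->].
have r20 : 0 < r / 2 by rewrite divr_gt0.
have [N hN] := ha _ r20; have [M hM] := hb _ r20.
exists (maxn N M) => // n /=; rewrite geq_max => /andP[Nn Mn].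
rewrite distrC.
have -> : s n - (a +i* b)%C =
    ((complex.Re (s n) - a)%R +i* 0)%C + (0 +i* (complex.Im (s n) - b)%R)%C.
  by case: (s n) => x y; apply/eqP; rewrite eq_complex /= addr0 add0r !eqxx.
apply: le_lt_trans (ler_normD _ _) _.
rewrite !normc_def /= !expr0n /= add0r addr0 !sqrtr_sqr -rmorphD /= ltcR.
by rewrite [r]splitr ltrD ?hN ?hM.
Qed.

Lemma cvg_ge0C (s : nat -> C) (l : C) :
  (s : nat -> C^o) @ \oo --> (l : C^o) ->
  (exists N, forall n, (N <= n)%N -> 0 <= s n) -> 0 <= l.
Proof.
move=> /cvgrPdist_lt hl [N hN].
have dist e : 0 < e -> exists n, (0 <= s n) /\ `|l - s n| < (e%:C)%C.
  move=> e0; have [|M _ hM] := hl (e%:C)%C; first by rewrite ltcR.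
  by exists (maxn N M); split; [apply: hN|apply: hM => /=]; rewrite ?leq_maxl ?leq_maxr.
case: l hl dist => a b _ dist; rewrite lecE /= eq_sym.
apply/andP; split; [apply/negPn/negP => b0|rewrite leNgt; apply/negP => a0].
  have [|n [sn0 hn]] := dist `|b|; first by rewrite normr_gt0 eq_sym.
  move: hn.
  case: (s n) sn0 => x y; rewrite lecE /= => /andP[/eqP -> _].
  rewrite normc_def /= ltcR subr0 ltNge => /negP; apply.
  by rewrite -sqrtr_sqr ler_wsqrtr // lerDr sqr_ge0.
have [|n [sn0 hn]] := dist (- a); first by rewrite oppr_gt0.
move: hn.
case: (s n) sn0 => x y; rewrite lecE /= => /andP[_ x0].
rewrite normc_def /= ltcR ltNge => /negP; apply.
apply: le_trans (_ : Num.sqrt ((a - x) ^+ 2) <= _); last first.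
  by rewrite ler_wsqrtr // lerDl sqr_ge0.
by rewrite sqrtr_sqr distrC ger0_norm ?lerDr // subr_ge0 (le_trans (ltW a0)).
Qed.

Lemma cauchy_seqsP (u : cauchy_seqs) : form_cauchy u.
Proof. by have /asboolP := cauchy_valP u. Qed.

Lemma cauchy_bounded (u : cauchy_seqs) : exists2 M : C, 0 < M &
  exists N, forall n, (N <= n)%N -> p (u n) <= M.
Proof.
have [N hN] := cauchy_seqsP u (@ltr01 C).
exists (1 + p (u N)); first by rewrite ltr_wpDr ?form_norm_ge0.
exists N => n Nn; rewrite -[u n](subrK (u N)).
by apply: le_trans (form_normD _ _ _) _; rewrite lerD2r ltW // hN.
Qed.

Lemma cauchy_form_cvg (u v : cauchy_seqs) :
  cvgn (fun n => B (u n) (v n) : C^o).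
Proof.
apply: cauchy_cvgC => e e0.
have [a a0 [N1 h1]] := cauchy_bounded u; have [b b0 [N2 h2]] := cauchy_bounded v.
have [N3 h3] := cauchy_seqsP u (divr_gt0 (divr_gt0 e0 (ltr0n _ 2)) b0).
have [N4 h4] := cauchy_seqsP v (divr_gt0 (divr_gt0 e0 (ltr0n _ 2)) a0).
exists (maxn (maxn N1 N2) (maxn N3 N4)) => m n.
rewrite !geq_max => /andP[/andP[m1 m2] /andP[m3 m4]] /andP[/andP[n1 n2] /andP[n3 n4]].
have -> : B (u m) (v m) - B (u n) (v n) = B (u m - u n) (v m) + B (u n) (v m - v n).
  by rewrite formDl formDr formNl formNr addrA subrK.
apply: le_lt_trans (ler_normD _ _) _; rewrite [e]splitr ltrD //.
  apply: le_lt_trans (form_norm_CS _ _ _) _.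
  apply: le_lt_trans (_ : p (u m - u n) * b < _).
    by rewrite ler_wpM2l ?form_norm_ge0 ?h2.
  by rewrite -ltr_pdivlMr // h3.
apply: le_lt_trans (form_norm_CS _ _ _) _.
apply: le_lt_trans (_ : a * p (v m - v n) < _).
  by rewrite ler_wpM2r ?form_norm_ge0 ?h1.
by rewrite mulrC -ltr_pdivlMr // h4.
Qed.

Definition cauchy_form (u v : cauchy_seqs) : C :=
  limn (fun n => B (u n) (v n) : C^o).

Lemma cauchy_formP (u v : cauchy_seqs) :
  (fun n => B (u n) (v n) : C^o) @ \oo --> (cauchy_form u v : C^o).
Proof. exact: cauchy_form_cvg. Qed.

Lemma cauchy_form_eq (u v : cauchy_seqs) (l : C) :
  (fun n => B (u n) (v n) : C^o) @ \oo --> (l : C^o) -> cauchy_form u v = l.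
Proof. exact: cvg_lim. Qed.

Lemma conj_cvgC (s : nat -> C) (l : C) : (s : nat -> C^o) @ \oo --> (l : C^o) ->
  (fun n => (s n)^* : C^o) @ \oo --> (l^* : C^o).
Proof.
move=> /cvgrPdist_lt h; apply/cvgrPdist_lt => e e0.
have [N _ hN] := h e e0; exists N => // n Nn.
by rewrite -rmorphB norm_conjC; apply: hN.
Qed.

Lemma scale_cvgC (c : C) (s : nat -> C) (l : C) : (s : nat -> C^o) @ \oo --> (l : C^o) ->
  (fun n => c * s n : C^o) @ \oo --> (c * l : C^o).
Proof.
move=> /cvgrPdist_lt h; apply/cvgrPdist_lt => e e0.
have c1 : 0 < `|c| + 1 by rewrite ltr_wpDl.
have [N _ hN] := h _ (divr_gt0 e0 c1); exists N => // n Nn.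
rewrite -mulrBr normrM; apply: le_lt_trans (_ : (`|c| + 1) * `|l - s n| < _).
  by rewrite ler_wpM2r // lerDl.
by rewrite mulrC -ltr_pdivlMr //; apply: hN.
Qed.

Let cauchy_form_bil :
  bilinear_for ( *%R ) (Num.conj \; *%R : GRing.Scale.law C C) cauchy_form.
Proof.
split=> [w c u v|w c u v]; apply: cauchy_form_eq.
  under eq_fun do rewrite /= formDl formZl.
  apply: cvgD; last exact: cauchy_formP.
  by apply: scale_cvgC; exact: cauchy_formP.
under eq_fun do rewrite /= formDr formZr.
apply: cvgD; last exact: cauchy_formP.
by apply: scale_cvgC; exact: cauchy_formP.
Qed.
HB.instance Definition _ := bilinear_isBilinear.Build C cauchy_seqs cauchy_seqs C
  ( *%R ) (Num.conj \; *%R) cauchy_form cauchy_form_bil.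
Let cauchy_form_herm x y :
  cauchy_form x y = (-1) ^+ false * Num.conj (cauchy_form y x).
Proof.
rewrite expr0 mul1r; apply: cauchy_form_eq.
under eq_fun do rewrite formC.
by apply: conj_cvgC; exact: cauchy_formP.
Qed.
HB.instance Definition _ := isHermitianSesquilinear.Build C cauchy_seqs false
  Num.conj cauchy_form cauchy_form_herm.

Lemma cauchy_form_ge0 u : 0 <= cauchy_form u u.
Proof.
by apply: cvg_ge0C (@cauchy_formP u u) _; exists 0%N => n _; exact: form_ge0.
Qed.

Definition cauchy_nonneg_form : nonneg_form cauchy_seqs :=
  NonnegForm (form_of := cauchy_form) cauchy_form_ge0.

Lemma cauchy_form_le (u : cauchy_seqs) (e : C) : 0 <= e ->
  (exists N, forall n, (N <= n)%N -> p (u n) <= e) ->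
  form_norm cauchy_nonneg_form u <= e.
Proof.
move=> e0 [N hN]; rewrite -(@ler_pXn2r _ 2) ?nnegrE ?form_norm_ge0 //.
rewrite form_norm_sq -subr_ge0; apply: cvg_ge0C (_ : (fun n => e ^+ 2 - B (u n) (u n) : C^o) @ \oo --> _) _.
  by apply: cvgB; [exact: cvg_cst|exact: cauchy_formP].
exists N => n Nn; rewrite subr_ge0 -form_norm_sq ler_pXn2r ?nnegrE ?form_norm_ge0 //.
exact: hN.
Qed.

Fact cauchy_cst_subproof (d : D) : (fun _ : nat => d) \in cauchy_pred.
Proof.
apply/asboolP => e e0; exists 0%N => m n _ _.
by rewrite subrr /form_norm form0l sqrtC0.
Qed.
Definition cauchy_cst (d : D) : cauchy_seqs := CauchySeq (cauchy_cst_subproof d).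

(* The Hilbert space associated with B: the Cauchy sequences of D for the
   seminorm of B, modulo the null vectors of the limit form, i.e. modulo the
   sequences whose seminorm tends to 0.  The null vectors of B itself die in
   this quotient, so this is the completion of D modulo them. *)
Definition hilbert_completion := null_quotient cauchy_nonneg_form.
Definition completion_proj (u : cauchy_seqs) : hilbert_completion :=
  null_proj cauchy_nonneg_form u.
Definition completion_embed (d : D) : hilbert_completion :=
  completion_proj (cauchy_cst d).

End cauchy_sequences.

Fact inner_ge0 (R : realType) (V : innerType R) (v : V) : 0 <= inner v v.
Proof. exact: (dnorm_ge0 (@inner_form R V) v). Qed.

Definition inner_nonneg_form (R : realType) (V : innerType R) : nonneg_form V :=
  NonnegForm (form_of := @inner_form R V) (@inner_ge0 R V).

Section completion.
Variables (R : realType) (D : lmodType R[i]) (B : nonneg_form D).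
Local Notation C := R[i].
Local Notation H := (hilbert_completion B).

HB.instance Definition _ := GRing.Lmodule.on H.
HB.instance Definition _ := InnerSpace.on H.

Let cnorm (x : H) : C := form_norm (inner_nonneg_form H) x.

Let cnormE (u : cauchy_seqs B) :
  cnorm (completion_proj u) = form_norm (cauchy_nonneg_form B) u.
Proof. by rewrite /cnorm /form_norm; congr sqrtC; exact: null_quotient_formE. Qed.

Let cnormD x y : cnorm (x + y) <= cnorm x + cnorm y.
Proof. exact: form_normD. Qed.
Let cnormZ (c : C) x : cnorm (c *: x) = `|c| * cnorm x.
Proof. exact: form_normZ. Qed.
Let cnorm0 x : cnorm x = 0 -> x = 0.
Proof.
by move=> /eqP; rewrite /cnorm sqrtC_eq0 => /eqP h; apply/eqP;
  rewrite -(dnorm_eq0 (@inner_form R H)); apply/eqP.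
Qed.
HB.instance Definition _ := Lmodule_isNormed.Build C H cnormD cnormZ cnorm0.

Fact completion_embed_is_linear : linear (@completion_embed R D B).
Proof.
move=> c u v; rewrite /completion_embed /completion_proj.
by rewrite -linearP; congr null_proj; apply: val_inj; apply: funext => n.
Qed.
HB.instance Definition _ := GRing.isLinear.Build C D H *:%R (@completion_embed R D B)
  completion_embed_is_linear.

Lemma inner_completion_embed (u v : D) :
  inner (completion_embed B u) (completion_embed B v) = B u v.
Proof.
by rewrite [LHS]null_quotient_formE; apply: cauchy_form_eq; exact: (cvg_cst (B u v : C^o)).
Qed.

Lemma completion_embed_approx (u : cauchy_seqs B) (e : C) : 0 < e ->
  exists N, forall n, (N <= n)%N ->
    `|completion_proj u - completion_embed B (u n)| <= e.
Proof.
move=> e0; have [N hN] := cauchy_seqsP u e0; exists N => n Nn.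
rewrite /completion_embed /completion_proj -linearB.
rewrite [leLHS](cnormE (u - cauchy_cst B (u n))).
by apply: cauchy_form_le (ltW e0) _; exists N => m Nm; apply/ltW/hN.
Qed.

Lemma completion_embed_near (x : H) (e : C) : 0 < e ->
  exists d : D, `|x - completion_embed B d| < e.
Proof.
move=> e0; elim/null_proj_ind: x => u.
have [N hN] := completion_embed_approx u (divr_gt0 e0 (ltr0n _ 2)).
exists (u N); apply: le_lt_trans (hN N _) _ => //.
by rewrite ltr_pdivrMr // ltr_pMr // ltr1n.
Qed.

Lemma completion_embed_dense : dense (range (@completion_embed R D B)).
Proof.
move=> U [x Ux] Uo; have := open_nbhs_nbhs (conj Uo Ux).
rewrite -nbhs_ballE => -[e e0 xeU]; have [d hd] := completion_embed_near x e0.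
exists (completion_embed B d); split; last by exists d.
by apply: xeU; rewrite -ball_normE.
Qed.

Lemma completion_complete (F : set_system H) : ProperFilter F -> cauchy F -> cvg F.
Proof.
move=> PF /cauchyP Fc.
have e_gt0 n : 0 < n.+1%:R^-1 :> C by rewrite invr_gt0 ltr0n.
have /choice[x hx] n : exists x : H, F (ball x n.+1%:R^-1) by exact: Fc.
have /choice[d hd] n : exists d : D, `|x n - completion_embed B d| < n.+1%:R^-1.
  exact: completion_embed_near.
have small (e : C) : 0 < e -> exists N, forall n, (N <= n)%N -> n.+1%:R^-1 < e.
  move=> e0; have [r [r0 ->]] : exists r : R, 0 < r /\ e = r%:C%C.
    by exists (complex.Re e); case: e e0 => a b; rewrite ltcE /= => /andP[/eqP-> ->].
  have [N _ hN] : \forall n \near \oo, n.+1%:R^-1 < r.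
    exact: near_infty_natSinv_lt (PosNum r0).
  exists N => n Nn; have := hN n Nn; rewrite -ltcR.
  by rewrite (rmorphV (real_complex R)) ?unitfE ?pnatr_eq0 //= rmorph_nat.
have dc : form_cauchy B d.
  move=> e e0; have [N hN] := small (e / 2 / 2) (divr_gt0 (divr_gt0 e0 (ltr0n _ 2)) (ltr0n _ 2)).
  exists N => m n Nm Nn.
  have -> : form_norm B (d m - d n) = `|completion_embed B (d m) - completion_embed B (d n)|.
    by rewrite -linearB /form_norm -inner_completion_embed.
  have [z [/= zm zn]] := filter_ex (filterI (hx m) (hx n)).
  rewrite -ball_normE /= in zm; rewrite -ball_normE /= in zn.
  have -> : completion_embed B (d m) - completion_embed B (d n) =
    - (x m - completion_embed B (d m)) + (x m - z) + (- (x n - z) + (x n - completion_embed B (d n))).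
    by rewrite !opprB !addrA !subrK.
  rewrite [e]splitr [e / 2]splitr.
  apply: le_lt_trans (ler_normD _ _) _; apply: ltrD;
    apply: le_lt_trans (ler_normD _ _) _; rewrite normrN; apply: ltrD.
  - exact: lt_trans (hd m) (hN m Nm).
  - exact: lt_trans zm (hN m Nm).
  - exact: lt_trans zn (hN n Nn).
  - exact: lt_trans (hd n) (hN n Nn).
have dP : d \in cauchy_pred B by apply/asboolP.
pose l : H := completion_proj (CauchySeq dP).
apply/cvg_ex; exists l; apply/cvgrPdist_lt => e e0.
have e3 : 0 < e / 2 / 2 by rewrite !divr_gt0.
have [N1 hN1] := small _ e3.
have [N2 hN2] := completion_embed_approx (CauchySeq dP) e3.
pose n := maxn N1 N2.
apply: filterS (hx n) => z; rewrite -ball_normE /= => hz.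
have -> : l - z = (l - completion_embed B (d n)) + (- (x n - completion_embed B (d n)) + (x n - z)).
  by rewrite opprB !addrA !subrK.
rewrite [e]splitr; apply: le_lt_trans (ler_normD _ _) _; apply: ler_ltD.
  apply: le_trans (hN2 n _) _; first exact: leq_maxr.
  by rewrite ler_pdivrMr // ler_peMr ?ler1n // ltW // divr_gt0.
rewrite [e / 2]splitr; apply: le_lt_trans (ler_normD _ _) _; rewrite normrN.
by apply: ltrD; [exact: lt_trans (hd n) (hN1 n (leq_maxl _ _))|
  exact: lt_trans hz (hN1 n (leq_maxl _ _))].
Qed.
HB.instance Definition _ := Uniform_isComplete.Build H completion_complete.

Let completion_inner_norm (x : H) : inner x x = `|x| ^+ 2.
Proof. by rewrite [RHS](form_norm_sq (inner_nonneg_form H)). Qed.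
HB.instance Definition _ := Inner_isHilbert.Build R H completion_inner_norm.

End completion.

(* A group with a topology, with no compatibility required: the multiplication
   of an inductive limit of topological groups need not be jointly continuous.
   The distinguished point (needed for Borel sigma-algebras) is arbitrary. *)
#[short(type="preTopologicalGroupType")]
HB.structure Definition PreTopologicalGroup := {G of Group G & PointedTopological G}.

Definition is_topological_group (G : preTopologicalGroupType) : Prop :=
  continuous (fun p : G * G => (p.1 * p.2)%g) /\ continuous (fun g : G => (g^-1)%g).

Definition separable_space (T : topologicalType) : Prop :=
  exists2 S : set T, countable S & dense S.

Definition completely_metrizable (R : realType) (T : topologicalType) : Prop :=
  exists d : T -> T -> R,
    [/\ forall x y, d x y = 0 <-> x = y,
        forall x y, d x y = d y x,
        forall x y z, d x z <= d x y + d y z,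
        forall x (A : set T), nbhs x A <->
          exists2 e : R, 0 < e & [set y | d x y < e] `<=` A &
        forall u : nat -> T,
          (forall e : R, 0 < e -> exists N, forall m n,
             (N <= m)%N -> (N <= n)%N -> d (u m) (u n) < e) ->
          exists l : T, u @ \oo --> l].

Definition polish (R : realType) (T : topologicalType) : Prop :=
  separable_space T /\ completely_metrizable R T.

Record polish_direct_limit (R : realType) (G : preTopologicalGroupType) :=
  PolishDirectLimit {
  stage : nat -> preTopologicalGroupType;
  stage_topological_group : forall j, is_topological_group (stage j);
  stage_polish : forall j, polish R (stage j);
  stage_next : forall j, stage j -> stage j.+1;
  stage_nextM : forall j, {morph @stage_next j : x y / (x * y)%g};
  stage_next_inj : forall j, injective (@stage_next j);
  stage_next_open : forall j (U : set (stage j)), open U <->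
    exists2 V : set (stage j.+1), open V & U = @stage_next j @^-1` V;
  stage_in : forall j, stage j -> G;
  stage_inM : forall j, {morph @stage_in j : x y / (x * y)%g};
  stage_in_inj : forall j, injective (@stage_in j);
  stage_in_next : forall j x, stage_in (@stage_next j x) = stage_in x;
  stage_cover : \bigcup_j range (@stage_in j) = setT;
  limit_open : forall U : set G, open U <-> forall j, open (@stage_in j @^-1` U) }.

Record compact_subgroup (G : preTopologicalGroupType) (K : set G) : Prop :=
  CompactSubgroup {
  subgroup_compact : compact K;
  subgroup1 : K 1%g;
  subgroupM : forall x y, K x -> K y -> K (x * y)%g;
  subgroupV : forall x, K x -> K (x^-1)%g }.

Section complex_measures.
Variables (R : realType) (d : measure_display) (T : measurableType d).
Local Notation C := R[i].
Local Open Scope complex_scope.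

Definition is_complex_measure (mu : set T -> C) : Prop :=
  exists a b : {charge set T -> \bar R},
    forall A, measurable A -> mu A = fine (a A) +i* fine (b A).

Definition complex_of_measure (m : {measure set T -> \bar R}) : set T -> C :=
  fun A => (fine (m A))%:C.

(* A complex measure is written m 0 + i m 1 - m 2 - i m 3 with finite positive
   measures m k (Jordan); the value z does not depend on the decomposition. *)
Definition has_cintegral (mu : set T -> C) (f : T -> C) (z : C) : Prop :=
  exists m : 'I_4 -> {finite_measure set T -> \bar R},
    [/\ forall A, measurable A ->
          mu A = \sum_(k < 4) 'i%C ^+ k * complex_of_measure (m k) A,
        forall k, (m k).-integrable setT (EFin \o (@complex.Re R \o f)) /\
                  (m k).-integrable setT (EFin \o (@complex.Im R \o f)) &
        z = \sum_(k < 4) 'i%C ^+ k *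
          (Rintegral (m k) setT (@complex.Re R \o f) +i*
           Rintegral (m k) setT (@complex.Im R \o f))].

Definition cintegral (mu : set T -> C) (f : T -> C) : C :=
  xget 0 [set z | has_cintegral mu f z].

End complex_measures.

(* Same formula as the library's product_measure1. *)
Definition cproduct (R : realType) (d1 d2 : measure_display)
    (T1 : measurableType d1) (T2 : measurableType d2)
    (mu1 : set T1 -> R[i]) (mu2 : set T2 -> R[i]) : set (T1 * T2) -> R[i] :=
  fun A => cintegral mu1 (fun x => mu2 (xsection A x)).

Definition borel (G : preTopologicalGroupType) := g_sigma_algebraType (@open G).

Definition convolution (R : realType) (G : preTopologicalGroupType)
    (mu1 mu2 : set (borel G) -> R[i]) : set (borel G) -> R[i] :=
  fun A => cproduct mu1 mu2 [set p : G * G | A (p.1 * p.2)%g].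

Definition point_mass (R : realType) (G : preTopologicalGroupType) (g : G) :
    set (borel G) -> R[i] :=
  complex_of_measure (@dirac _ (borel G) g R).

Definition compactly_supported (R : realType) (G : preTopologicalGroupType)
    (mu : set (borel G) -> R[i]) : Prop :=
  exists2 S : set G, compact S &
    forall A : set (borel G), measurable A -> A `&` S = set0 -> mu A = 0.

Definition measure_algebra (R : realType) (G : preTopologicalGroupType) :
    set (set (borel G) -> R[i]) :=
  [set mu | is_complex_measure mu /\ compactly_supported mu].

(* A left-invariant probability on a compact group is also right-invariant. *)
Definition haar_probability (R : realType) (G : preTopologicalGroupType)
    (K : set G) (m : probability (borel G) R) : Prop :=
  m (~` K) = 0%E /\
  forall (k : G) (A : set (borel G)), K k -> measurable A ->
    m [set g : G | A (k * g)%g] = m A.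

(* hecke R K is M(G//K). *)
Section hecke.
Variables (R : realType) (G : preTopologicalGroupType) (K : set G).

Definition is_hecke (mu : set (borel G) -> R[i]) : Prop :=
  measure_algebra mu /\
  forall (k : G) (A : set (borel G)), K k -> measurable A ->
    mu [set g : G | A (k * g)%g] = mu A /\ mu [set g : G | A (g * k)%g] = mu A.

Record hecke := Hecke {
  hecke_val :> set (borel G) -> R[i];
  hecke_valP : `[< is_hecke hecke_val >] }.
HB.instance Definition _ := [isSub for hecke_val].

Fact hecke0_subproof : `[< is_hecke (fun=> 0) >].
Proof.
apply/asboolP; do 2?split => //; last by exists set0 => //; exact: compact0.
by exists (@czero _ (borel G) R : {charge set (borel G) -> \bar R}), (@czero _ (borel G) R : {charge set (borel G) -> \bar R}) => A mA; rewrite /czero.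
Qed.
Definition hecke0 : hecke := Hecke hecke0_subproof.

End hecke.

Record unitary_rep (R : realType) (G : preTopologicalGroupType)
    (H : hilbertType R) := UnitaryRep {
  rep :> G -> {linear H -> H};
  rep1 : forall v, rep 1%g v = v;
  repM : forall g h v, rep (g * h)%g v = rep g (rep h v);
  rep_unitary : forall g v w, inner (rep g v) (rep g w) = inner v w;
  rep_continuous : forall v, continuous (fun g => rep g v) }.

Definition unitary_equivalent (R : realType) (G : preTopologicalGroupType)
    (H1 H2 : hilbertType R) (pi1 : unitary_rep G H1) (pi2 : unitary_rep G H2) : Prop :=
  exists U : {linear H1 -> H2},
    [/\ bijective U,
        forall v w, inner (U v) (U w) = inner v w &
        forall g v, U (pi1 g v) = pi2 g (U v)].

(* The vector u = rho(mu) v, with the operator rho(mu) understood as a weak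
   integral. *)
Definition rep_measure (R : realType) (G : preTopologicalGroupType)
    (H : hilbertType R) (rho : unitary_rep G H) (mu : set (borel G) -> R[i])
    (v : H) : H :=
  xget 0 [set u | forall w : H,
    has_cintegral mu (fun g : G => inner (rho g v) w) (inner u w)].

Section fixed_vectors.
Variables (R : realType) (G : preTopologicalGroupType) (H : hilbertType R).
Variables (rho : unitary_rep G H) (K : set G).

Definition fixed_pred : {pred H} :=
  fun v => `[< forall k, K k -> rho k v = v >].

Fact fixed_submod : submod_closed fixed_pred.
Proof.
split=> [|c u v /asboolP hu /asboolP hv]; apply/asboolP => k Kk.
  exact: linear0.
by rewrite linearP hu // hv.
Qed.
HB.instance Definition _ :=
  GRing.isSubmodClosed.Build R[i] H fixed_pred fixed_submod.

Record fixed := Fixed { fixed_val : H; fixed_valP : fixed_val \in fixed_pred }.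
HB.instance Definition _ := [isSub for fixed_val].
HB.instance Definition _ := [Choice of fixed by <:].
HB.instance Definition _ := [SubChoice_isSubLmodule of fixed by <:].

Definition fixed_inner (u v : fixed) : R[i] := inner (fixed_val u) (fixed_val v).

Let fixed_bil :
  bilinear_for ( *%R ) (Num.conj \; *%R : GRing.Scale.law R[i] R[i]) fixed_inner.
Proof.
split=> w c u v.
  by rewrite -[LHS]/(inner_nonneg_form H (c *: fixed_val u + fixed_val v) (fixed_val w)) formDl formZl.
by rewrite -[LHS]/(inner_nonneg_form H (fixed_val w) (c *: fixed_val u + fixed_val v)) formDr formZr.
Qed.
HB.instance Definition _ := bilinear_isBilinear.Build R[i] fixed fixed R[i]
  ( *%R ) (Num.conj \; *%R) fixed_inner fixed_bil.
Let fixed_herm u v :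
  fixed_inner u v = (-1) ^+ false * Num.conj (fixed_inner v u).
Proof. exact: (@hermitian_subproof _ _ _ _ (@inner_form R H)). Qed.
HB.instance Definition _ := isHermitianSesquilinear.Build R[i] fixed false
  Num.conj fixed_inner fixed_herm.
Let fixed_dot u : u != 0 -> 0 < fixed_inner u u.
Proof.
move=> u0; rewrite /fixed_inner /inner dnorm_gt0.
by apply: contra_neq u0 => u0; exact: val_inj.
Qed.
HB.instance Definition _ :=
  isDotProduct.Build R[i] fixed fixed_inner fixed_dot.
HB.instance Definition _ := Lmodule_hasInner.Build R fixed fixed_inner.

Definition cyclic_fixed : Prop :=
  dense [set v : H | exists n (c : 'I_n -> R[i]) (g : 'I_n -> G) (eta : 'I_n -> fixed),
    v = \sum_(i < n) c i *: rho (g i) (fixed_val (eta i))].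

(* The operator rho(nu) preserves the K-fixed vectors, so that insubd only
   changes the type of rho(nu) v. *)
Definition Res (nu : hecke R K) (v : fixed) : fixed :=
  insubd (0 : fixed) (rep_measure rho nu (fixed_val v)).

End fixed_vectors.

(* coset_space K is K\G, the set of the cosets K g. *)
Section coset_space.
Variables (G : preTopologicalGroupType) (K : set G).

Record coset_space := CosetSpace {
  coset_set :> set G;
  coset_setP : exists g, coset_set = [set (k * g)%g | k in K] }.

HB.instance Definition _ := gen_eqMixin coset_space.
HB.instance Definition _ := gen_choiceMixin coset_space.

Definition coset_repr (x : coset_space) : G := projT1 (cid (coset_setP x)).

Fact coset_shift_subproof (x : coset_space) (r : G) :
  exists g, [set (y * r)%g | y in coset_set x] = [set (k * g)%g | k in K].
Proof.
have [g ->] := coset_setP x; exists (g * r)%g; apply/seteqP; split=> z /=.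
  by move=> [_ [k Kk <-] <-]; exists k => //; rewrite mulgA.
by move=> [k Kk <-]; exists (k * g)%g; rewrite ?mulgA //; exists k.
Qed.
Definition coset_shift (x : coset_space) (r : G) : coset_space :=
  CosetSpace (coset_shift_subproof x r).

Lemma coset_shift_inj r : injective (coset_shift^~ r).
Proof.
move=> [A hA] [B hB] /= [/seteqP[AB BA]].
have E : A = B.
  apply/seteqP; split=> z hz.
    by have [|y hy /mulIg <-//] := AB (z * r)%g; exists z.
  by have [|y hy /mulIg <-//] := BA (z * r)%g; exists z.
by rewrite E in hA *; congr CosetSpace; exact: Prop_irrelevance.
Qed.

End coset_space.

(* Delta K V is the space of finitely supported functions K\G -> V. *)
Section Delta.
Variables (R : realType) (G : preTopologicalGroupType) (K : set G).
Variable (V : innerType R).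

Definition finsupp_pred : {pred (coset_space K -> V)} :=
  fun f => `[< finite_set [set x | f x != 0] >].

Fact finsupp_submod : submod_closed finsupp_pred.
Proof.
split=> [|c u v /asboolP hu /asboolP hv]; apply/asboolP.
  by rewrite (_ : [set x | _] = set0) // -subset0 => x /=; rewrite eqxx.
apply: (sub_finite_set _ (_ : finite_set ([set x | u x != 0] `|` [set x | v x != 0]))).
  move=> x /= h; apply: contrapT => /not_orP[/negP/negPn/eqP ux /negP/negPn/eqP vx].
  by move: h; rewrite -[(c *: u + v) x]/(c *: u x + v x) ux vx scaler0 addr0 eqxx.
by rewrite finite_setU.
Qed.
HB.instance Definition _ :=
  GRing.isSubmodClosed.Build R[i] (coset_space K -> V) finsupp_pred finsupp_submod.

Record Delta := DeltaFun {
  Delta_val :> coset_space K -> V;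
  Delta_valP : Delta_val \in finsupp_pred }.
HB.instance Definition _ := [isSub for Delta_val].
HB.instance Definition _ := [Choice of Delta by <:].
HB.instance Definition _ := [SubChoice_isSubLmodule of Delta by <:].

Definition Delta_supp (f : Delta) : set (coset_space K) := [set x | f x != 0].

Fact Delta_shift_subproof (r : G) (f : Delta) :
  (fun x => f (coset_shift x r)) \in finsupp_pred.
Proof.
have /asboolP hf := Delta_valP f; apply/asboolP.
pose sh (x : coset_space K) := coset_shift x r.
have inj : {in sh @^-1` [set x | Delta_val f x != 0] &, injective sh}.
  by move=> x y _ _; exact: coset_shift_inj.
exact: finite_preimage inj hf.
Qed.
Definition Delta_shift (r : G) (f : Delta) : Delta :=
  DeltaFun (Delta_shift_subproof r f).

Variables (deltaK : probability (borel G) R) (tau : hecke R K -> V -> V).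

(* L(x, y).  The convolution is bi-invariant under K, so that insubd only
   changes its type, and it does not depend on the representatives. *)
Definition rep_kernel (x y : coset_space K) : V -> V :=
  let dK := complex_of_measure deltaK in
  tau (insubd (hecke0 R K)
    (convolution
      (convolution dK (point_mass R (coset_repr y * (coset_repr x)^-1)%g)) dK)).

Definition Delta_form (f1 f2 : Delta) : R[i] :=
  \sum_(a \in Delta_supp f1) \sum_(b \in Delta_supp f2)
    inner (rep_kernel a b (f1 a)) (f2 b).

End Delta.

(* Main.v *)
Require Import Defs.
From HB Require Import structures.
From mathcomp Require Import all_boot all_order all_algebra sesquilinear.
From mathcomp Require Import complex.
From mathcomp Require Import all_classical all_reals all_analysis.
From mathcomp Require Import measurable_realfun ring lra.

Set Implicit Arguments.
Unset Strict Implicit.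
Unset Printing Implicit Defensive.

Import Order.TTheory GRing.Theory Num.Theory.
Import numFieldNormedType.Exports.
Local Open Scope classical_set_scope.
Local Open Scope ring_scope.

(** For K-fixed vectors v and w, the operator of delta_K * g * delta_K satisfies
<rho(delta_K * g * delta_K) v, w> = <rho(g) v, w>, because x |-> <rho(x) v, w> is
constant on the double coset K g K, which carries the measure.  For g = h_b h_a^-1
this says that the kernel is a Gram kernel:

  <L(a, b) v, w> = <rho(h_a)^-1 v, rho(h_b)^-1 w>,     a = K h_a, b = K h_b.

Hence the synthesis map f |-> sum_a rho(h_a)^-1 f(a) carries the form of
Delta(K\G, tau) to the inner product of H: the form is nonnegative
([rep_kernelE]).  The synthesis map intertwines the shifts with rho
([synthesis_shift]), and its range is dense because the K-fixed vectors are
cyclic ([synthesis_dense]); a densely ranged linear map that preserves the forms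
extends to a unitary map from the completion onto H ([completion_extension]),
along which rho is transported ([transport_rep]).

The work lies in the measure delta_K * g * delta_K itself.  It has to be an
element of M(G//K), and its operator, which is a weak integral, has to exist.
Multiplication in a direct limit is only separately continuous, so the Borel
measurability of x |-> delta_K(x^-1 A) is not a matter of product measures: for
open A this function is lower semicontinuous on every stage, by continuity of
delta_K from below, and a Dynkin argument reaches all Borel A
([measurable_shift]).  Joint continuity is available inside a stage, and compact
sets lie in one ([compact_in_stage]).  The stage that contains K is second
countable, and Fubini on K x K gives the invariance of delta_K under inversion and therefore on the right
([haar_inv], [haar_right]).  The operator of the measure exists by the Riesz
representation theorem ([real_riesz]), and the value of an integral against it
does not depend on the decomposition into positive parts that is used
([has_cintegralP]). *)

(** * Real inner products and the Riesz representation theorem *)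

Lemma positive_complex (R : realType) (e : R[i]) :
  0 < e -> exists r : R, 0 < r /\ e = r%:C%C.
Proof.
by case: e => x y; rewrite ltcE /= => /andP[/eqP-> x0]; exists x.
Qed.

Section real_inner.
Variables (R : realType) (H : innerType R).
Implicit Types u v w : H.

Definition rinner u v : R := complex.Re (inner u v).

Lemma innerC u v : inner u v = (inner v u)^*.
Proof. exact: (@Defs.formC _ _ (inner_nonneg_form H)). Qed.
Lemma innerDl u v w : inner (u + v) w = inner u w + inner v w.
Proof. exact: (@Defs.formDl _ _ (inner_nonneg_form H)). Qed.
Lemma innerZl c u w : inner (c *: u) w = c * inner u w.
Proof. exact: (@Defs.formZl _ _ (inner_nonneg_form H)). Qed.
Lemma innerDr w u v : inner w (u + v) = inner w u + inner w v.
Proof. exact: (@Defs.formDr _ _ (inner_nonneg_form H)). Qed.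
Lemma innerZr w c u : inner w (c *: u) = c^* * inner w u.
Proof. exact: (@Defs.formZr _ _ (inner_nonneg_form H)). Qed.
Lemma inner0l w : inner 0 w = 0.
Proof. exact: (@Defs.form0l _ _ (inner_nonneg_form H)). Qed.
Lemma inner0r w : inner w 0 = 0.
Proof. by rewrite innerC inner0l rmorph0. Qed.

Lemma rinnerC u v : rinner u v = rinner v u.
Proof. by rewrite /rinner innerC; case: (inner v u). Qed.
Lemma rinnerDl u v w : rinner (u + v) w = rinner u w + rinner v w.
Proof. by rewrite /rinner innerDl raddfD. Qed.
Lemma rinnerDr w u v : rinner w (u + v) = rinner w u + rinner w v.
Proof. by rewrite rinnerC rinnerDl !(rinnerC w). Qed.
Lemma rinnerZl (c : R) u w : rinner (c%:C%C *: u) w = c * rinner u w.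
Proof.
by rewrite /rinner innerZl; case: (inner u w) => a b /=; rewrite mul0r subr0.
Qed.
Lemma rinnerZr (c : R) u w : rinner w (c%:C%C *: u) = c * rinner w u.
Proof. by rewrite rinnerC rinnerZl rinnerC. Qed.
Lemma rinnerNl u w : rinner (- u) w = - rinner u w.
Proof. by apply/eqP; rewrite -addr_eq0 -rinnerDl addNr /rinner inner0l. Qed.
Lemma rinnerNr u w : rinner w (- u) = - rinner w u.
Proof. by rewrite rinnerC rinnerNl rinnerC. Qed.

Lemma rinner_ge0 u : 0 <= rinner u u.
Proof. by have := inner_ge0 u; rewrite /rinner lecE /= => /andP[]. Qed.

Lemma inner_rinner u : inner u u = ((rinner u u)%:C)%C.
Proof.
have := inner_ge0 u; rewrite /rinner lecE; case: (inner u u) => a b /=.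
by move=> /andP[/eqP->].
Qed.

(** The imaginary part of the inner product is the real inner product with a vector
turned by i, so that every complex statement below follows from a real one. *)
Lemma Im_inner u v : complex.Im (inner u v) = rinner u ('i%C *: v).
Proof.
rewrite /rinner innerZr; case: (inner u v) => a b.
rewrite -[_^*]/((0 +i* 1)^*%C)%C /=.
by rewrite mul0r sub0r mulN1r opprK.
Qed.

Definition rnorm u : R := Num.sqrt (rinner u u).

Lemma rnorm_ge0 u : 0 <= rnorm u.
Proof. exact: sqrtr_ge0. Qed.

Lemma rnorm_sq u : rnorm u ^+ 2 = rinner u u.
Proof. by rewrite sqr_sqrtr // rinner_ge0. Qed.

Lemma rinner_CauchySchwarz u v : `|rinner u v| <= rnorm u * rnorm v.
Proof.
have h : rinner u v ^+ 2 <= rinner u u * rinner v v.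
  have : `|inner u v| ^+ 2 <= inner u u * inner v v.
    exact: (form_CauchySchwarz (inner_nonneg_form H)).
  rewrite !inner_rinner normc_def -!rmorphXn -rmorphM /= lecR sqr_sqrtr; last first.
    by rewrite addr_ge0 ?sqr_ge0.
  by apply: le_trans; rewrite lerDl sqr_ge0.
rewrite -(@ler_pXn2r _ 2) ?nnegrE ?normr_ge0 ?mulr_ge0 ?rnorm_ge0 //.
by rewrite real_normK ?num_real // exprMn !rnorm_sq.
Qed.

Lemma rnorm0 : rnorm 0 = 0.
Proof. by rewrite /rnorm /rinner inner0l sqrtr0. Qed.

Lemma rnormN u : rnorm (- u) = rnorm u.
Proof. by rewrite /rnorm rinnerNl rinnerNr opprK. Qed.

Lemma rnormD u v : rnorm (u + v) <= rnorm u + rnorm v.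
Proof.
rewrite -(@ler_pXn2r _ 2) ?nnegrE ?addr_ge0 ?rnorm_ge0 //.
rewrite sqrrD !rnorm_sq rinnerDl !rinnerDr (rinnerC v u).
have := le_trans (ler_norm _) (rinner_CauchySchwarz u v); lra.
Qed.

End real_inner.

Section hilbert.
Variables (R : realType) (H : hilbertType R).
Implicit Types u v w : H.

Lemma normr_rnorm u : `|u| = ((rnorm u)%:C)%C.
Proof.
apply/eqP; rewrite -(@eqrXn2 _ 2) ?normr_ge0 //; last first.
  by rewrite lecE /= eqxx rnorm_ge0.
by rewrite -inner_norm inner_rinner -rnorm_sq rmorphXn.
Qed.

Lemma rnorm_eq0 u : rnorm u = 0 -> u = 0.
Proof. by move=> h; apply/eqP; rewrite -normr_eq0 normr_rnorm h. Qed.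

Lemma inner_ext u v : (forall w, rinner u w = rinner v w) -> u = v.
Proof.
move=> h; apply/eqP; rewrite -subr_eq0; apply/eqP/rnorm_eq0.
by rewrite /rnorm rinnerDl rinnerNl h subrr sqrtr0.
Qed.

(** Norm convergence, stated with the real-valued norm so that estimates stay in
the ordered field R. *)
Definition rcvg (u : nat -> H) (l : H) := forall e : R, 0 < e ->
  exists N, forall n, (N <= n)%N -> rnorm (u n - l) < e.

Lemma rcvg_cauchy (u : nat -> H) :
  (forall e : R, 0 < e -> exists N, forall m n, (N <= m)%N -> (N <= n)%N ->
     rnorm (u m - u n) < e) -> exists l, rcvg u l.
Proof.
move=> hu; have : cvgn u.
  apply: cauchy_cvg; apply: cauchy_exP => e e0.
  have [r [r0 ->]] := positive_complex e0.
  have [N hN] := hu _ r0; exists (u N); exists N => // n /= Nn.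
  by rewrite -ball_normE /= normr_rnorm ltcR; exact: hN.
move=> /cvg_ex[l /cvgrPdist_lt hl]; exists l => e e0.
have [|N _ hN] := hl e%:C%C; first by rewrite ltcR.
exists N => n Nn; rewrite -rnormN opprB -ltcR -normr_rnorm; exact: hN.
Qed.

Lemma rcvg_rinner (u v : nat -> H) (l m : H) : rcvg u l -> rcvg v m ->
  (fun n => rinner (u n) (v n)) @ \oo --> rinner l m.
Proof.
move=> ul vm; apply/cvgrPdist_lt => e e0.
have l0 := rnorm_ge0 l; have m0 := rnorm_ge0 m.
pose d := Num.min 1 (e / (rnorm l + rnorm m + 2)).
have d0 : 0 < d by rewrite lt_min ltr01 divr_gt0 //; lra.
have [N1 h1] := ul _ d0; have [N2 h2] := vm _ d0.
exists (maxn N1 N2) => // n /=; rewrite geq_max => /andP[n1 n2].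
have -> : rinner l m - rinner (u n) (v n) =
    - rinner (u n - l) (v n - m) - rinner l (v n - m) - rinner (u n - l) m.
  by rewrite !(rinnerDl, rinnerDr, rinnerNl, rinnerNr); ring.
have := rinner_CauchySchwarz (u n - l) (v n - m).
have := rinner_CauchySchwarz l (v n - m).
have := rinner_CauchySchwarz (u n - l) m.
have := h1 n n1; have := h2 n n2.
have d1 : d <= 1 by rewrite ge_min lexx.
have de : d * (rnorm l + rnorm m + 2) <= e.
  by rewrite -ler_pdivlMr; [rewrite ge_min lexx orbT|lra].
have := rnorm_ge0 (u n - l); have := rnorm_ge0 (v n - m).
move: (rnorm _) (rnorm (u n - l)) => a b a0 b0 ad bd A1 A2 A3.
apply: le_lt_trans (ler_normD _ _) _; rewrite normrN.
apply: le_lt_trans (lerD (ler_normD _ _) (lexx _)) _; rewrite !normrN.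
nra.
Qed.

Lemma rcvg_unique (u : nat -> H) (l m : H) : rcvg u l -> rcvg u m -> l = m.
Proof.
move=> ul um; apply: inner_ext => w.
have wc : rcvg (fun=> w) w by move=> e e0; exists 0%N => n _; rewrite subrr rnorm0.
by rewrite -(cvg_lim _ (rcvg_rinner ul wc)) // -(cvg_lim _ (rcvg_rinner um wc)).
Qed.

(** Minimise the functional |w|^2 - 2 psi(w): by the parallelogram identity a
minimising sequence is Cauchy, and its limit represents psi. *)
Lemma real_riesz (psi : H -> R) (M : R) :
  {morph psi : u v / u + v} -> (forall (c : R) u, psi (c%:C%C *: u) = c * psi u) ->
  (forall u, `|psi u| <= M * rnorm u) ->
  exists u, forall w, rinner u w = psi w.
Proof.
move=> psiD psiZ psiM.
pose J w := rinner w w - 2 * psi w.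
pose S := [set J w | w in [set: H]].
have Jlb w : - M ^+ 2 <= J w.
  rewrite /J -rnorm_sq; have := le_trans (ler_norm _) (psiM w).
  by have := sqr_ge0 (rnorm w - M); lra.
have Sinf : has_inf S.
  by split; [exists (J 0), 0|exists (- M ^+ 2) => _ [w _ <-]; exact: Jlb].
have Jinf w : inf S <= J w by apply: ge_inf; [exact: Sinf.2|exists w].
have JD w h : J (w + h) = J w + 2 * (rinner w h - psi h) + rinner h h.
  by rewrite /J psiD rinnerDl !rinnerDr (rinnerC h w); ring.
have /choice[x hx] n : exists w, J w < inf S + n.+1%:R^-1.
  have [|_ [w _ <-] hw] := @inf_adherent _ S n.+1%:R^-1 _ Sinf; last by exists w.
  by rewrite invr_gt0.
have near w e h : J w < inf S + e -> (rinner w h - psi h) ^+ 2 <= e * rinner h h.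
  move=> we; set D := _ - _.
  have key (s : R) : 0 <= e + 2 * s * D + s ^+ 2 * rinner h h.
    have := Jinf (w + s%:C%C *: h).
    rewrite JD rinnerZl !rinnerZr psiZ -mulrBr -/D.
    move: (J w) (inf S) (D) (rinner h h) we => a b c f; lra.
  have [h0|h0] := eqVneq (rinner h h) 0.
    (* Here key is affine in s, and this s makes it negative unless D = 0. *)
    have := key (- (e + 1) / (2 * D)); have := key 0.
    have [->|D0] := eqVneq D 0; first by move=> _ _; rewrite h0 expr0n mulr0.
    rewrite h0 !mulr0 !addr0.
    have -> : 2 * (- (e + 1) / (2 * D)) * D = - (e + 1) by field.
    lra.
  have hp : 0 < rinner h h by rewrite lt_def h0 rinner_ge0.
  (* The quadratic polynomial in s is smallest at this value. *)
  have := key (- D / rinner h h).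
  have -> : e + 2 * (- D / rinner h h) * D + (- D / rinner h h) ^+ 2 * rinner h h
     = e - D ^+ 2 / rinner h h by field.
  by rewrite subr_ge0 ler_pdivrMr.
have [|u hu] := @rcvg_cauchy x.
  move=> e e0.
  have [N _ hN] : \forall n \near \oo, n.+1%:R^-1 < e ^+ 2 / 4.
    have e4 : 0 < e ^+ 2 / 4 by rewrite divr_gt0 ?exprn_gt0.
    exact: near_infty_natSinv_lt (PosNum e4).
  exists N => m n Nm Nn.
  rewrite -(@ltr_pXn2r _ 2) ?nnegrE ?rnorm_ge0 ?ltW // rnorm_sq.
  have := hN m Nm; have := hN n Nn; have := hx m; have := hx n.
  have := Jinf ((2^-1)%:C%C *: (x m + x n)).
  rewrite /J psiZ psiD rinnerZl rinnerZr !rinnerDl !rinnerDr !rinnerNl !rinnerNr.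
  rewrite (rinnerC (x n) (x m)) /=.
  move: (m.+1%:R^-1) (n.+1%:R^-1) => a b; lra.
exists u => h.
have cst : rcvg (fun=> h) h by move=> e e0; exists 0%N => n _; rewrite subrr rnorm0.
rewrite -(cvg_lim _ (rcvg_rinner hu cst)) //; apply: cvg_lim => //.
apply/cvgrPdist_lt => e e0.
pose d := e ^+ 2 / (rinner h h + 1).
have h0 := rinner_ge0 h.
have d0 : 0 < d by rewrite divr_gt0 ?exprn_gt0 //; lra.
have [N _ hN] := near_infty_natSinv_lt (PosNum d0).
exists N => // n Nn; rewrite distrC.
rewrite -(@ltr_pXn2r _ 2) ?nnegrE ?normr_ge0 ?ltW // real_normK ?num_real //.
apply: le_lt_trans (near _ _ h (hx n)) _.
apply: le_lt_trans (_ : d * rinner h h < _).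
  by rewrite ler_wpM2r // ltW //; exact: hN.
have -> : e ^+ 2 = d * (rinner h h + 1) by rewrite /d mulfVK //; lra.
by rewrite ltr_pM2l //; lra.
Qed.

End hilbert.

(** * Unitary extension to the completion *)

Lemma linear_of_fun (K : nzRingType) (U V : lmodType K) (f : U -> V) :
  linear f -> exists F : {linear U -> V}, F =1 f.
Proof.
move=> lf.
pose F : {linear U -> V} := HB.pack f (GRing.isLinear.Build K U V *:%R f lf).
by exists F.
Qed.

Section cvg.
Variables (R : realType) (H : hilbertType R).

Lemma rcvgP (u : nat -> H) (l : H) : rcvg u l <-> u @ \oo --> l.
Proof.
split=> [ul|/cvgrPdist_lt hl e e0].
  apply/cvgrPdist_lt => e e0.
  have [r [r0 ->]] := positive_complex e0.
  have [N hN] := ul _ r0; exists N => // n /= Nn.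
  by rewrite distrC normr_rnorm ltcR; exact: hN.
have [|N _ hN] := hl e%:C%C; first by rewrite ltcR.
exists N => n Nn; rewrite -rnormN opprB -ltcR -normr_rnorm; exact: hN.
Qed.

Lemma rcvgZD (c : R[i]) (u v : nat -> H) (l m : H) :
  rcvg u l -> rcvg v m -> rcvg (fun n => c *: u n + v n) (c *: l + m).
Proof.
move=> /rcvgP ul /rcvgP vm; apply/rcvgP; apply: cvgD => //.
exact: cvgZr.
Qed.

Lemma cvg_complex (s : nat -> R[i]) (l : R[i]) :
  (fun n => complex.Re (s n)) @ \oo --> complex.Re l ->
  (fun n => complex.Im (s n)) @ \oo --> complex.Im l ->
  (s : nat -> R[i]^o) @ \oo --> (l : R[i]^o).
Proof.
move=> /cvgrPdist_lt hr /cvgrPdist_lt hi; apply/cvgrPdist_lt => e e0.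
have [r [r0 ->]] := positive_complex e0.
have r20 : 0 < r / 2 by rewrite divr_gt0.
have [N _ hN] := hr _ r20; have [M _ hM] := hi _ r20.
exists (maxn N M) => // n /=; rewrite geq_max => /andP[/hN /= h1 /hM /= h2].
move: h1 h2; case: l hr hi hN hM => a b _ _ _ _; case: (s n) => x y /= h1 h2.
have -> : ((a +i* b) - (x +i* y) = ((a - x) +i* 0) + (0 +i* (b - y)))%C.
  by apply/eqP; rewrite eq_complex /= addr0 add0r !eqxx.
apply: le_lt_trans (ler_normD _ _) _.
rewrite !normc_def /= !expr0n /= add0r addr0 !sqrtr_sqr -rmorphD /= ltcR.
by rewrite [r]splitr ltrD.
Qed.

Lemma rcvg_inner (u v : nat -> H) (l m : H) : rcvg u l -> rcvg v m ->
  (fun n => inner (u n) (v n) : R[i]^o) @ \oo --> (inner l m : R[i]^o).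
Proof.
move=> ul vm; apply: cvg_complex; first exact: rcvg_rinner.
under eq_fun do rewrite Im_inner.
rewrite Im_inner; apply: rcvg_rinner => //.
by apply/rcvgP; apply: cvgZr; exact/rcvgP.
Qed.

End cvg.

Section extension.
Variables (R : realType) (D : lmodType R[i]) (B : nonneg_form D).
Variable H : hilbertType R.
Variable T : {linear D -> H}.
Hypothesis BT : forall u v, B u v = inner (T u) (T v).
Hypothesis T_dense : dense (range T).

Lemma form_norm_rnorm u : form_norm B u = ((rnorm (T u))%:C)%C.
Proof.
by rewrite -normr_rnorm /form_norm BT inner_norm sqrCK.
Qed.

(** B is the pullback of the inner product along T, so its Cauchy sequences are the
sequences that T maps to Cauchy sequences of H. *)
Lemma form_cauchyP (u : nat -> D) : form_cauchy B u <->
  forall e : R, 0 < e -> exists N, forall m n, (N <= m)%N -> (N <= n)%N ->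
     rnorm (T (u m) - T (u n)) < e.
Proof.
split=> hu e e0.
  have [|N hN] := hu e%:C%C; first by rewrite ltcR.
  exists N => m n Nm Nn; have := hN m n Nm Nn.
  by rewrite form_norm_rnorm ltcR linearB.
have [r [r0 ->]] := positive_complex e0.
have [N hN] := hu _ r0; exists N => m n Nm Nn.
by rewrite form_norm_rnorm ltcR linearB; exact: hN.
Qed.

(** A point of the completion is sent to the limit of the images of its
representing sequence.  The map is onto because a sequence of D whose images
converge in H is Cauchy for B. *)
Lemma completion_extension : exists U : {linear hilbert_completion B -> H},
  [/\ bijective U, forall x y, inner (U x) (U y) = inner x y &
      forall d, U (completion_embed B d) = T d].
Proof.
have /choice[L hL] (u : cauchy_seqs B) : exists l, rcvg (T \o u) l.
  by apply: rcvg_cauchy; apply/form_cauchyP; exact: cauchy_seqsP.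
have LB u v : inner (L u) (L v) = cauchy_form u v.
  symmetry; apply: cauchy_form_eq.
  under eq_fun do rewrite BT.
  exact: (rcvg_inner (hL u) (hL v)).
have Llin : linear L.
  move=> c u v; apply: rcvg_unique (hL _) _.
  rewrite (_ : T \o _ = fun n => c *: (T \o u) n + (T \o v) n); last first.
    by apply/funext => n /=; rewrite -linearP.
  exact: rcvgZD.
have [L' L'E] := linear_of_fun Llin.
have Lproj u v : completion_proj u = completion_proj v -> L u = L v.
  move=> /null_projP; rewrite /null_eqv => /eqP h.
  apply/eqP; rewrite -subr_eq0 -!L'E -linearB L'E.
  by rewrite -normr_eq0 -sqrf_eq0 -inner_norm LB; apply/eqP.
pose U0 (x : hilbert_completion B) := L (repr x).
have U0E u : U0 (completion_proj u) = L u.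
  by apply: Lproj; rewrite /completion_proj; exact: reprK.
have U0lin : linear U0.
  move=> c; elim/null_proj_ind => u; elim/null_proj_ind => v.
  by rewrite -linearP !U0E Llin.
have [U UE] := linear_of_fun U0lin.
have Uinner x y : inner (U x) (U y) = inner x y.
  rewrite !UE; elim/null_proj_ind: x => u; elim/null_proj_ind: y => v.
  by rewrite !U0E LB [RHS]null_quotient_formE.
exists U; split=> //.
- have Uinj : injective U.
    move=> x y xy; apply/eqP; rewrite -subr_eq0 -normr_eq0 -sqrf_eq0 -inner_norm.
    by rewrite -Uinner linearB xy subrr inner0l.
  have Usurj h : exists x, U x = h.
    have /choice[d hd] (n : nat) : exists d, rnorm (T d - h) < n.+1%:R^-1.
      pose E := ball h (n.+1%:R^-1)%:C%C.
      have [|z [/= hz [d _ dz]]] := T_dense _ (open_interior E).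
        exists h; apply: nbhsx_ballx; rewrite ltcR //.
      exists d; move: hz => /interior_subset.
      by rewrite dz /E -ball_normE /= distrC normr_rnorm ltcR.
    have dc : form_cauchy B d.
      apply/form_cauchyP => e e0.
      have e20 : 0 < e / 2 by rewrite divr_gt0.
      have [N _ hN] := near_infty_natSinv_lt (PosNum e20).
      exists N => m n Nm Nn; have := hN m Nm; have := hN n Nn => /=.
      have := hd m; have := hd n.
      have := rnormD (T (d m) - h) (- (T (d n) - h)).
      rewrite rnormN opprB addrA subrK.
      move: (m.+1%:R^-1) (n.+1%:R^-1) => a b; lra.
    have dP : d \in cauchy_pred B by apply/asboolP.
    exists (completion_proj (CauchySeq dP)); rewrite UE U0E.
    apply: rcvg_unique (hL _) _ => e e0.
    have [N _ hN] := near_infty_natSinv_lt (PosNum e0).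
    by exists N => n Nn; apply: lt_trans (hd n) _; exact: hN.
  have /choice[V VK] := Usurj.
  by exists V => // x; apply: Uinj; rewrite VK.
- move=> d; rewrite UE U0E; apply: rcvg_unique (hL _) _ => e e0.
  by exists 0%N => n _; rewrite /= subrr rnorm0.
Qed.

End extension.

Section transport.
Variables (R : realType) (G : preTopologicalGroupType) (H1 H2 : hilbertType R).
Variables (U : {linear H1 -> H2}) (rho : unitary_rep G H2).
Hypothesis U_bij : bijective U.
Hypothesis U_inner : forall x y, inner (U x) (U y) = inner x y.

Lemma transport_rep : exists sigma : unitary_rep G H1,
  forall g v, U (sigma g v) = rho g (U v).
Proof.
have [V UK VK] := U_bij.
have Ucont (x y : H1) : `|U x - U y| = `|x - y|.
  by rewrite -linearB !normr_rnorm /rnorm /rinner U_inner.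
have /choice[s sE] (g : G) : exists F : {linear H1 -> H1}, F =1 V \o rho g \o U.
  apply: linear_of_fun => c x y; apply: (can_inj UK).
  by rewrite /= VK !linearP /= !VK.
have UsE g v : U (s g v) = rho g (U v) by rewrite sE /= VK.
have sigma1 v : s 1%g v = v.
  by apply: (can_inj UK); rewrite UsE rep1.
have sigmaM g h v : s (g * h)%g v = s g (s h v).
  by apply: (can_inj UK); rewrite !UsE repM.
have sigmaU g v w : inner (s g v) (s g w) = inner v w.
  by rewrite -U_inner !UsE rep_unitary U_inner.
have sigmaC v : continuous (fun g => s g v).
  move=> g; apply/cvgrPdist_lt => e e0.
  have := @rep_continuous _ _ _ rho (U v) g => /cvgrPdist_lt /(_ e e0).
  by apply: filterS => h; rewrite -!UsE Ucont.
by exists (UnitaryRep sigma1 sigmaM sigmaU sigmaC).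
Qed.

End transport.

(** * Topology of a direct limit of Polish groups *)

Lemma morph_mul1 (A B : groupType) (f : A -> B) :
  {morph f : x y / (x * y)%g} -> f 1%g = 1%g.
Proof. by move=> fM; apply: (@mulIg _ (f 1%g)); rewrite -fM !mul1g. Qed.

Lemma morph_mulV (A B : groupType) (f : A -> B) :
  {morph f : x y / (x * y)%g} -> {morph f : x / (x^-1)%g}.
Proof.
by move=> fM x; apply: (@mulIg _ (f x)); rewrite -fM !mulVg morph_mul1.
Qed.

Lemma continuous_mulg (P : preTopologicalGroupType) (T : topologicalType)
    (f h : T -> P) : is_topological_group P -> continuous f -> continuous h ->
  continuous (fun x => (f x * h x)%g).
Proof.
move=> [mc _] fc hc x.
apply: (@continuous_comp _ _ _ (fun x => (f x, h x)) (fun p => (p.1 * p.2)%g)).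
  by apply: cvg_pair; [exact: fc|exact: hc].
exact: mc.
Qed.

Lemma continuous_invg (P : preTopologicalGroupType) (T : topologicalType)
    (f : T -> P) : is_topological_group P -> continuous f ->
  continuous (fun x => (f x)^-1%g).
Proof. by move=> [_ ic] fc x; exact: continuous_comp (fc x) (ic (f x)). Qed.

(** Balls of half the distance of two points are disjoint. *)
Lemma completely_metrizable_hausdorff (R : realType) (T : topologicalType) :
  completely_metrizable R T -> hausdorff_space T.
Proof.
move=> [d [d0 dC dD nbhsd _]] x y xy; apply/d0/eqP; rewrite eq_le.
have xx z : d z z = 0 by apply/d0.
apply/andP; split; last first.
  by have := dD x y x; rewrite xx (dC y x); lra.
rewrite leNgt; apply/negP => e0.
have e20 : 0 < d x y / 2 by rewrite divr_gt0.
have [||z [/= h1 h2]] := xy [set z | d x z < d x y / 2] [set z | d y z < d x y / 2].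
- by apply/nbhsd; exists (d x y / 2).
- by apply/nbhsd; exists (d x y / 2).
by have := dD x z y; rewrite (dC z y); lra.
Qed.

Section direct_limit.
Variables (R : realType) (G : preTopologicalGroupType).
Variable L : polish_direct_limit R G.
Local Notation P := (stage L).
Local Notation in_ j := (@stage_in R G L j).

Lemma stage_hausdorff j : hausdorff_space (P j).
Proof. exact: completely_metrizable_hausdorff (stage_polish L j).2. Qed.

Lemma stage_in_continuous j : continuous (in_ j).
Proof. by apply/continuousP => U /(limit_open L); exact. Qed.

Lemma stage_next_continuous j : continuous (@stage_next R G L j).
Proof. by apply/continuousP => U Uo; apply/stage_next_open; exists U. Qed.

Lemma stage_lift (i n : nat) : exists2 f : P i -> P (n + i)%N, continuous f &
  forall x, in_ (n + i)%N (f x) = in_ i x.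
Proof.
elim: n => [|n [f fc fE]]; first by exists id => // x; exact: cvg_id.
exists (@stage_next R G L _ \o f) => [x|x /=]; last by rewrite stage_in_next.
by apply: continuous_comp; [exact: fc|exact: stage_next_continuous].
Qed.

Lemma stage_le (i l : nat) : (i <= l)%N -> exists2 f : P i -> P l, continuous f &
  forall x, in_ l (f x) = in_ i x.
Proof. by move=> /subnK <-; exact: stage_lift. Qed.

Lemma stage_mem g : exists j x, in_ j x = g.
Proof.
have : [set: G] g by [].
by rewrite -(stage_cover L) => -[j _ [x _ <-]]; exists j, x.
Qed.

Lemma range_stage_in i l : (i <= l)%N -> range (in_ i) `<=` range (in_ l).
Proof. by move=> il _ [x _ <-]; have [f _ fE] := stage_le il; exists (f x). Qed.

(** The stages carry the subspace topology of the limit: an open set of a stage is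
extended step by step to the later stages, and the union of the extensions is
open in the limit. *)
Lemma stage_in_open j (U : set (P j)) : open U ->
  exists2 V : set G, open V & U = in_ j @^-1` V.
Proof.
move=> Uo.
have ext (p : {i & set (P i)}) : exists V : set (P (projT1 p).+1),
    open (projT2 p) -> open V /\ projT2 p = @stage_next R G L _ @^-1` V.
  case: p => i W /=; have [Wo|?] := pselect (open W); last by exists set0.
  by have /stage_next_open[V Vo WV] := Wo; exists V.
pose nxt p := projT1 (cid (ext p)).
have nxtP p : open (projT2 p) ->
    open (nxt p) /\ projT2 p = @stage_next R G L _ @^-1` (nxt p).
  exact: (projT2 (cid (ext p))).
pose W := fix W n : set (P (n + j)%N) :=
  match n return set (P (n + j)%N) with
  | 0 => U | n'.+1 => nxt (existT _ (n' + j)%N (W n')) end.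
have Wo n : open (W n).
  by elim: n => [|n Wo] //=; have [] := nxtP (existT _ (n + j)%N (W n)) Wo.
have WS n : W n = @stage_next R G L _ @^-1` (W n.+1).
  by have [] := nxtP (existT _ (n + j)%N (W n)) (Wo n).
have push n k (y : P (n + j)%N) : exists2 y' : P (k + n + j)%N,
    in_ _ y' = in_ _ y & W n y <-> W (k + n)%N y'.
  elim: k => [|k [y' yy' Wy]]; first by exists y.
  exists (@stage_next R G L _ y'); first by rewrite stage_in_next.
  by rewrite Wy WS.
(* W n is the trace on stage n + j of the open set V under construction. *)
pose V := \bigcup_n (in_ (n + j)%N @` W n).
have VW n : in_ (n + j)%N @^-1` V = W n.
  apply/seteqP; split=> [y [m _ [z Wz yz]]|y Wy]; last by exists n => //; exists y.
  have [nm|/ltnW mn] := leqP n m.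
    have [y' yy' ->] := push n (m - n)%N y; rewrite subnK // in y' yy' *.
    by rewrite (_ : y' = z) //; apply: (@stage_in_inj R G L); rewrite yz yy'.
  have [z' zz'] := push m (n - m)%N z; rewrite subnK // in z' zz' *.
  move=> [/(_ Wz) Wz' _]; rewrite (_ : y = z') //.
  by apply: (@stage_in_inj R G L); rewrite -yz zz'.
exists V; last by rewrite -[U]/(W 0%N) -VW.
apply/(limit_open L) => i.
have [h hc hE] := stage_le (leq_addr j i).
rewrite (_ : _ @^-1` V = h @^-1` W i).
  by move/continuousP: hc; apply; exact: Wo.
by rewrite -VW; apply/seteqP; split=> x /=; rewrite hE.
Qed.

Lemma continuous_stage_in (T : topologicalType) j (f : T -> P j) :
  continuous f -> continuous (fun x => in_ j (f x)).
Proof.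
by move=> fc x; exact: continuous_comp (fc x) (@stage_in_continuous j _).
Qed.

(** Translation by g is a continuous map of every stage that contains g, and the
other stages embed in one of those.  Joint continuity fails in general. *)
Lemma mulgr_continuous (g : G) : continuous (fun x : G => (x * g)%g).
Proof.
have [l [y <-]] := stage_mem g.
apply/continuousP => U Uo; apply/(limit_open L) => i.
have [f fc fE] := stage_le (leq_addl l i).
have [h hc hE] := stage_le (leq_addr i l).
rewrite (_ : _ @^-1` _ = (fun x => in_ _ (f x * h y)%g) @^-1` U); last first.
  by apply/seteqP; split=> x /=; rewrite stage_inM fE hE.
move: U Uo; apply/continuousP; apply: continuous_stage_in.
apply: continuous_mulg => //; first exact: stage_topological_group.
by move=> x; exact: cvg_cst.
Qed.

Lemma mulgl_continuous (g : G) : continuous (fun x : G => (g * x)%g).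
Proof.
have [l [y <-]] := stage_mem g.
apply/continuousP => U Uo; apply/(limit_open L) => i.
have [f fc fE] := stage_le (leq_addl l i).
have [h hc hE] := stage_le (leq_addr i l).
rewrite (_ : _ @^-1` _ = (fun x => in_ _ (h y * f x)%g) @^-1` U); last first.
  by apply/seteqP; split=> x /=; rewrite stage_inM fE hE.
move: U Uo; apply/continuousP; apply: continuous_stage_in.
apply: continuous_mulg => //; first exact: stage_topological_group.
by move=> x; exact: cvg_cst.
Qed.

Lemma invg_continuous : continuous (fun x : G => (x^-1)%g).
Proof.
apply/continuousP => U Uo; apply/(limit_open L) => i.
rewrite (_ : _ @^-1` _ = (fun x => in_ i (x^-1)%g) @^-1` U); last first.
  by apply/seteqP; split=> x /=; rewrite (morph_mulV (@stage_inM _ _ L i)).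
move: U Uo; apply/continuousP; apply: continuous_stage_in.
exact: (stage_topological_group L i).2.
Qed.

(** A sequence of points of K outside larger and larger stages would have no
cluster point, since its tails are closed. *)
Lemma compact_in_stage (K : set G) : compact K -> exists j, K `<=` range (in_ j).
Proof.
move=> cK; apply: contrapT => /forallNP noj.
have /choice[x hx] j : exists x, K x /\ ~ range (in_ j) x.
  by have /existsNP[x /not_implyP[Kx nx]] := noj j; exists x.
have [] := cK (x @ \oo) _; first by exists 0%N => // n _; exact: (hx n).1.
move=> p [Kp clp].
have [i [y yp]] := stage_mem p.
(* A stage contains only finitely many of the points x k, hence V is open. *)
pose V := ~` [set x k | k in [set k | (i <= k)%N]].
have Vo : open V.
  apply/(limit_open L) => l.
  rewrite (_ : _ @^-1` V =
    ~` (in_ l @^-1` [set x k | k in [set k | (i <= k)%N]])) //.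
  rewrite openC.
  have [+ _] := @accessible_finite_set_closed (P l); apply.
    exact/hausdorff_accessible/stage_hausdorff.
  apply: (@sub_finite_set _ _ (in_ l @^-1` (x @` `I_l))).
    move=> z /= [k ik xk]; exists k => //=; rewrite ltnNge; apply/negP => lk.
    by have [_] := hx k; apply; rewrite xk; apply: range_stage_in lk _ _; exists z.
  apply: finite_preimage; last exact/finite_image/finite_II.
  by move=> a b _ _; exact: stage_in_inj.
have pV : nbhs p V.
  apply: open_nbhs_nbhs; split=> // -[k /= ik xk].
  have [_] := hx k; apply; rewrite xk -yp; apply: (range_stage_in ik).
  by exists y.
have [|z [[k ik <-]]] := clp [set x k | k in [set k | (i <= k)%N]] V _ pV.
  by exists i => // k /= ik; exists k.
by apply; exists k.
Qed.

(** The stage has the subspace topology, so cluster points in G that lie in K are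
cluster points in the stage. *)
Lemma compact_stage_preimage j (K : set G) : compact K -> K `<=` range (in_ j) ->
  compact (in_ j @^-1` K).
Proof.
move=> cK Kj F PF FK.
have [|p [Kp clp]] := cK (in_ j @ F) _ _; first exact: FK.
have [x _ xp] := Kj p Kp; exists x; split; first by rewrite /= xp.
move=> A B FA; rewrite nbhsE => -[U [Uo Ux] UB].
have [V Vo UV] := stage_in_open Uo.
have [||z [[y Ay <-] Vz]] := clp (in_ j @` A) V.
- have : F (in_ j @^-1` (in_ j @` A)) by apply: filterS FA => y Ay; exists y.
  exact.
- by apply: open_nbhs_nbhs; split=> //; rewrite -xp; move: Ux; rewrite UV.
by exists y; split=> //; apply: UB; rewrite UV.
Qed.

Lemma compact_closed_limit (K : set G) : compact K -> closed K.
Proof.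
move=> cK; have [j Kj] := compact_in_stage cK.
rewrite -openC; apply/(limit_open L) => l.
have [f fc fE] := stage_le (leq_addr j l).
rewrite (_ : _ @^-1` _ = f @^-1` (~` (in_ _ @^-1` K))); last first.
  by apply/seteqP; split=> x /=; rewrite fE.
move/continuousP: fc; apply; rewrite openC.
apply: compact_closed; first exact: stage_hausdorff.
apply: compact_stage_preimage => //.
by apply: subset_trans Kj _; apply: range_stage_in; exact: leq_addl.
Qed.

(** K and g lie in a common stage, where multiplication is jointly continuous. *)
Lemma compact_mulKgK (K : set G) (g : G) : compact K ->
  compact [set (p.1 * g * p.2)%g | p in K `*` K].
Proof.
move=> cK; have [j Kj] := compact_in_stage cK; have [l [y yg]] := stage_mem g.
have [f fc fE] := stage_le (leq_addl j l).
pose n := (j + l)%N; pose K' := in_ n @^-1` K.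
have Kn : K `<=` range (in_ n).
  by apply: subset_trans Kj _; apply: range_stage_in; exact: leq_addr.
have cK' : compact K' by exact: compact_stage_preimage.
rewrite (_ : [set _ | p in _] =
    (fun p : P n * P n => in_ n (p.1 * f y * p.2)%g) @` (K' `*` K')); last first.
  apply/seteqP; split=> z /=.
    move=> [[a b] /= [Ka Kb] <-].
    have [a' _ aa] := Kn a Ka; have [b' _ bb] := Kn b Kb.
    by exists (a', b'); rewrite /K' /= ?aa ?bb // !stage_inM fE aa bb yg.
  move=> [[a b] /= [Ka Kb] <-]; exists (in_ n a, in_ n b) => //=.
  by rewrite !stage_inM fE yg.
apply: continuous_compact; last exact: compact_setX.
apply: continuous_subspaceT; apply: continuous_stage_in.
have tg := stage_topological_group L n.
apply: continuous_mulg => //; last by move=> p; exact: cvg_snd.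
apply: continuous_mulg => // p; [exact: cvg_fst|exact: cvg_cst].
Qed.

End direct_limit.

(** * Translates of Borel sets and convolution of measures *)

Section borel.
Variable G : preTopologicalGroupType.

Lemma borel_open (U : set G) : open U -> measurable (U : set (borel G)).
Proof. exact: sub_sigma_algebra. Qed.

Lemma borel_closed (U : set G) : closed U -> measurable (U : set (borel G)).
Proof.
move=> cU; rewrite -[U]setCK; apply: (@measurableC _ (borel G)).
by apply: borel_open; rewrite openC.
Qed.

Lemma borel_measurable_fun (f : G -> G) : continuous f ->
  measurable_fun setT (f : borel G -> borel G).
Proof.
move=> /continuousP cf.
apply: (@measurability _ _ (borel G) (borel G) setT f (@open G)) => //.
by move=> _ [V Vo <-]; rewrite setTI; apply: borel_open; exact: cf.
Qed.

Lemma borel_preimage (f : G -> G) (A : set (borel G)) : continuous f ->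
  measurable A -> measurable (f @^-1` A : set (borel G)).
Proof.
by move=> /borel_measurable_fun fm mA; rewrite -[X in measurable X]setTI; exact: fm.
Qed.

Lemma borel_measurable_real (R : realType) (f : G -> R) : continuous f ->
  measurable_fun setT (f : borel G -> R).
Proof.
move=> /continuousP cf; apply: (measurability _ (RGenOpens.measurableE R)).
move=> _ [_ [a [b ->] <-]]; rewrite setTI; apply: borel_open; apply: cf.
exact: interval_open.
Qed.

End borel.

Section mass_one.
Context d (T : measurableType d) (R : realType) (mu : {measure set T -> \bar R}).
Hypothesis mu1 : mu setT = 1%E.

(** The proof of mass one is a parameter, so that the probability structure can be
found from the term. *)
Definition mass_one_probability of mu setT = 1%E : set T -> \bar R := mu.
HB.instance Definition _ := Measure.on (mass_one_probability mu1).
HB.instance Definition _ :=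
  Measure_isProbability.Build _ _ _ (mass_one_probability mu1) mu1.

End mass_one.

Section convolution_measure.
Variables (R : realType) (G : preTopologicalGroupType).
Variable L : polish_direct_limit R G.
Variable (m : probability (borel G) R).
Local Open Scope ereal_scope.

Lemma measurable_mulgl (x : G) (A : set (borel G)) : measurable A ->
  measurable ([set y | A (x * y)%g] : set (borel G)).
Proof.
by move=> mA; exact: (borel_preimage (@mulgl_continuous _ _ L x)).
Qed.

Lemma measurable_mulgr (x : G) (A : set (borel G)) : measurable A ->
  measurable ([set y | A (y * x)%g] : set (borel G)).
Proof.
by move=> mA; exact: (borel_preimage (@mulgr_continuous _ _ L x)).
Qed.

(** For open A the function is lower semicontinuous: along a convergent sequence
of a stage this is continuity of m from below. *)
Lemma open_shift_superlevel (A : set G) (c : \bar R) : open A ->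
  open [set x : G | c < m [set y | A (x * y)%g]].
Proof.
move=> Ao; apply/(limit_open L) => i; rewrite openE => x0 /= cx0.
have [d [d0 dC dD nbhsd _]] := (stage_polish L i).2.
apply: contrapT => nx0.
(* If x0 is not interior, it is a limit of points where the inequality fails. *)
have /choice[x hx] (n : nat) : exists x, (d x0 x < n.+1%:R^-1)%R /\
    m [set y | A (stage_in x * y)%g] <= c.
  apply: contrapT => /forallNP nx; apply: nx0; apply/nbhsd.
  exists (n.+1%:R^-1)%R => [|y /= yn]; first by rewrite invr_gt0.
  by rewrite ltNge; apply/negP => yc; apply: (nx y).
pose E n := [set y | A (stage_in (x n) * y)%g].
have mE n : measurable (E n : set (borel G)).
  by apply: measurable_mulgl; exact: borel_open.
pose D N := \bigcap_(n in [set n | (N <= n)%N]) E n.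
have mD N : measurable (D N : set (borel G)) by exact: bigcap_measurableType.
have sub : [set y | A (stage_in x0 * y)%g] `<=` \bigcup_N D N.
  move=> y /= Ay.
  have : nbhs x0 [set z | A (stage_in z * y)%g].
    apply: open_nbhs_nbhs; split => //.
    move/continuousP: (@mulgr_continuous _ _ L y) => /(_ A Ao).
    by move/continuousP: (@stage_in_continuous _ _ L i); apply.
  move=> /nbhsd[e e0 he].
  have [N _ hN] := near_infty_natSinv_lt (PosNum e0).
  exists N => // n /= Nn; apply: he => /=.
  by apply: lt_trans (hx n).1 _; exact: hN.
move: cx0; apply/negP; rewrite -leNgt.
apply: le_trans (_ : m (\bigcup_N D N) <= _).
  apply: le_measure; rewrite ?inE //.
    by apply: measurable_mulgl; exact: borel_open.
  exact: bigcup_measurable.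
have cv : (m \o D) n @[n --> \oo] --> m (\bigcup_N D N).
  apply: nondecreasing_cvg_mu => //; first exact: bigcup_measurable.
  move=> N M NM; apply/subsetPset => y Dy n /= Mn; apply: Dy.
  exact: leq_trans NM Mn.
rewrite -(cvg_lim _ cv) //; apply: lime_le.
  by apply/cvg_ex; eexists; exact: cv.
apply: nearW => N /=; apply: le_trans (hx N).2.
apply: le_measure; rewrite ?inE //; first exact: mE.
by move=> y; apply => /=.
Qed.

(** The class of Borel sets with this property contains the open sets and is closed
under complements and disjoint unions. *)
Lemma measurable_shift (A : set (borel G)) : measurable A ->
  measurable_fun setT (fun x : borel G => m [set y | A (x * y)%g]).
Proof.
apply: (@dynkin_induction _ (borel G) (@open G)
  (fun A => measurable_fun setT (fun x : borel G => m [set y | A (x * y)%g]))) => //.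
- by move=> U V; exact: openI.
- exact: (measurable_cst (m [set: borel G])).
- move=> U Uo; apply: (measurability _ (ErealGenOInfty.measurableE R)).
  move=> _ [_ [c ->] <-]; rewrite setTI; apply: borel_open.
  rewrite (_ : _ @^-1` _ = [set x : G | c%:E < m [set y | U (x * y)%g]]).
    exact: open_shift_superlevel.
  by apply/seteqP; split=> x /=; rewrite in_itv /= andbT.
- move=> S mS hS.
  rewrite (_ : (fun _ => _) = (fun x => 1 - m [set y | S (x * y)%g])).
    by apply: emeasurable_funB => //; exact: measurable_cst.
  apply/funext => x; rewrite -probability_setC //; exact: measurable_mulgl.
- move=> F mF tF hF.
  rewrite (_ : (fun _ => _) =
      (fun x => \sum_(0 <= i <oo) m [set y | F i (x * y)%g])).
    exact: ge0_emeasurable_sum.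
  apply/funext => x.
  rewrite -[LHS]/(m (\bigcup_n [set y | F n (x * y)%g])).
  apply: measure_semi_bigcup.
  + by move=> i; exact: measurable_mulgl.
  + by move=> i j _ _ [y [/= Fi Fj]]; apply: (tF i j) => //; exists (x * y)%g.
  + by apply: bigcup_measurable => i _; exact: measurable_mulgl.
Qed.

Lemma measurable_shift_mul (g : G) (A : set (borel G)) : measurable A ->
  measurable_fun setT (fun x : borel G => m [set y | A (x * g * y)%g]).
Proof.
move=> mA; have mr := borel_measurable_fun (@mulgr_continuous _ _ L g).
exact: (measurableT_comp (measurable_shift mA) mr).
Qed.

(** M is the convolution of m, the point mass at g and m, written as the iterated
integral of its definition; countable additivity is monotone convergence. *)
Lemma conv_measure_exists (g : G) : exists M : probability (borel G) R,
  forall A, measurable A -> M A = \int[m]_x m [set y | A (x * g * y)%g].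
Proof.
pose f (A : set (borel G)) := \int[m]_x m [set y | A (x * g * y)%g].
have f0 : f set0 = 0 by rewrite /f integral0_eq // => x _; rewrite measure0.
have f_ge0 A : 0 <= f A by apply: integral_ge0.
have fs : semi_sigma_additive f.
  move=> F mF tF mUF.
  rewrite [X in _ --> X](_ : _ = \sum_(n <oo) f (F n)).
    by apply/cvg_closeP; split; [exact: is_cvg_nneseries|rewrite closeE].
  rewrite -integral_nneseries //; last by move=> n; exact: measurable_shift_mul.
  apply: eq_integral => x _.
  rewrite -[LHS]/(m (\bigcup_n [set y | F n (x * g * y)%g])).
  apply: measure_semi_bigcup.
  + by move=> i; exact: measurable_mulgl.
  + by move=> i j _ _ [y [/= Fi Fj]]; apply: (tF i j) => //; exists (x * g * y)%g.
  + by apply: bigcup_measurable => i _; exact: measurable_mulgl.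
have fT : f setT = 1.
  rewrite /f (eq_integral (cst 1)); last by move=> x _; exact: (probability_setT m).
  by rewrite integral_cst // mul1e; exact: (probability_setT m).
pose M : {measure set (borel G) -> \bar R} :=
  HB.pack f (isMeasure.Build _ _ _ f f0 f_ge0 fs).
by exists (mass_one_probability (fT : M setT = 1)).
Qed.

End convolution_measure.

(** * Invariance and support of the measures obtained from Haar measure *)

(** The balls of radius 1/(n+1) around a dense sequence; their interiors are taken
because only neighbourhoods are described by the metric. *)
Lemma polish_countable_base (R : realType) (T : ptopologicalType) : polish R T ->
  exists2 W : nat -> set T, (forall n, open (W n)) &
    forall x A, nbhs x A -> exists2 n, W n x & W n `<=` A.
Proof.
move=> [[S cS dS] [d [d0 dC dD nbhsd _]]].
have xx z : d z z = 0 by apply/d0.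
have [s hs] : exists s : nat -> T, S `<=` range s.
  have /pfcard_geP[->|[f]] := cS; first by exists (fun=> point).
  by exists f => y Sy; have [n _ <-] := 'surj_f Sy; exists n.
pose W (p : nat * nat) := interior [set y | d (s p.1) y < p.2.+1%:R^-1].
have Wx p y : d (s p.1) y < p.2.+1%:R^-1 -> W p y.
  move=> h; apply/nbhsd; exists (p.2.+1%:R^-1 - d (s p.1) y).
    by rewrite subr_gt0.
  move=> z /=; have := dD (s p.1) y z; move: (_^-1) => a; lra.
exists (fun n => odflt set0 (omap W (unpickle n))) => [n|x A /nbhsd[e e0 eA]].
  by case: (unpickle n) => [p|] /=; [exact: open_interior|exact: open0].
have e20 : 0 < e / 2 by rewrite divr_gt0.
have [n _ hn] := near_infty_natSinv_lt (PosNum e20).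
have {}hn := hn n (leqnn n); rewrite /= in hn.
pose E := [set y | d x y < n.+1%:R^-1].
have [|y [/= xy Sy]] := dS (interior E) _ (open_interior _).
  by exists x; apply/nbhsd; exists n.+1%:R^-1 => //; rewrite invr_gt0.
have {}xy : d x y < n.+1%:R^-1 by have := interior_subset xy.
have [k _ ky] := hs y Sy.
exists (pickle (k, n)); rewrite pickleK /=; first by apply: Wx; rewrite /= ky dC.
move=> z /interior_subset /=; rewrite ky => yz; apply: eA => /=.
by have := dD x y z; move: hn xy yz; move: (_^-1) => a; lra.
Qed.

Section haar.
Variables (R : realType) (G : preTopologicalGroupType).
Variable L : polish_direct_limit R G.
Variables (K : set G) (cK : compact_subgroup K).
Variables (m : probability (borel G) R) (haarK : haar_probability K m).
Local Open Scope ereal_scope.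

Lemma measurable_subgroup : measurable (K : set (borel G)).
Proof.
apply: borel_closed; apply: (@compact_closed_limit _ _ L).
exact: subgroup_compact.
Qed.

(** K is compact, hence closed, hence Borel, and m vanishes on its complement. *)
Lemma haar_subgroupI (A : set (borel G)) : measurable A -> m (A `&` K) = m A.
Proof.
move=> mA; have mK := measurable_subgroup.
rewrite [RHS](measureDI m mA mK) -[LHS]add0e; congr (_ + _).
apply/esym/eqP; rewrite eq_le measure_ge0 andbT -haarK.1.
apply: le_measure; rewrite ?inE; [exact: measurableD|exact: measurableC|].
by move=> x [].
Qed.

(** The set is a countable union of rectangles, because a stage that contains K
is second countable and has a jointly continuous multiplication.  The Borel sets
of G x G need not belong to the product of the Borel sigma-algebras. *)
Lemma measurable_invmul_subgroup (A : set G) : open A ->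
  measurable ([set p | [/\ K p.1, K p.2 & A (p.1^-1 * p.2)%g]] :
    set (borel G * borel G)).
Proof.
move=> Ao; have [j Kj] := compact_in_stage L (subgroup_compact cK).
have mK := measurable_subgroup.
have [W Wo Wb] := polish_countable_base (stage_polish L j).
have /choice[V hV] n :
    exists V : set G, open V /\ W n = (@stage_in R G L j) @^-1` V.
  by have [V Vo ->] := stage_in_open (Wo n); exists V.
have tg := stage_topological_group L j.
pose f (p : stage L j * stage L j) := stage_in (p.1^-1 * p.2)%g : G.
have fc : continuous f.
  apply: continuous_stage_in; apply: continuous_mulg => // p; last exact: cvg_snd.
  by apply: (@continuous_invg (stage L j)) => // q; exact: cvg_fst.
have mVK n : measurable (V n `&` K : set (borel G)).
  by apply: measurableI => //; apply: borel_open; have [] := hV n.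
rewrite (_ : [set p | _] =
    \bigcup_n \bigcup_(k in [set k | W n `*` W k `<=` f @^-1` A])
      ((V n `&` K) `*` (V k `&` K))).
  apply: bigcup_measurable => n _; apply: bigcup_measurable => k _.
  exact: measurableX.
have fE a b : f (a, b) = ((stage_in a)^-1 * stage_in b)%g.
  by rewrite /f stage_inM (morph_mulV (@stage_inM _ _ L j)).
apply/seteqP; split=> [[x y] /= [Kx Ky Axy]|[x y] /=]; last first.
  move=> [n _ [k /= nk [[/= Vx Kx] [/= Vy Ky]]]].
  have [a _ ax] := Kj x Kx; have [b _ yb] := Kj y Ky.
  split=> //; rewrite -ax -yb -fE; apply: (nk (a, b)).
  by split; rewrite /= ?(hV n).2 ?(hV k).2 /= ?ax ?yb.
have [a _ ax] := Kj x Kx; have [b _ yb] := Kj y Ky.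
have : nbhs (a, b) (f @^-1` A).
  apply: open_nbhs_nbhs; split; last by rewrite /= fE ax yb.
  by move/continuousP : fc; apply.
move=> [[A1 A2] /= [/Wb[n Wa An] /Wb[k Wb' Ak]] A12].
exists n => //; exists k => /=.
  by move=> [c d] [/= /An Ac /Ak Ad]; apply: A12.
split; split=> //=; first by move: Wa; rewrite (hV n).2 /= ax.
by move: Wb'; rewrite (hV k).2 /= yb.
Qed.

Lemma integral_indic_subgroup (c : \bar R) : 0 <= c ->
  \int[m]_x ((\1_K x)%:E * c) = c.
Proof.
move=> c0; have mK := measurable_subgroup.
rewrite ge0_integralZr //; last exact: measurableT_comp.
rewrite integral_indic // setIT.
have mK1 : m K = 1.
  rewrite -[X in m X]setTI (haar_subgroupI (@measurableT _ (borel G))).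
  exact: (probability_setT m).
by rewrite -[RHS]mul1e; congr (_ * _).
Qed.

(** Integrate the indicator of x^-1 y in A over (x, y) in K x K in both orders.
Left invariance makes the inner integral over y equal to m(A), and the inner
integral over x, after x is replaced by y x, equal to m(A^-1). *)
Lemma haar_inv_open (A : set G) : open A -> m [set x | A (x^-1)%g] = m A.
Proof.
move=> Ao; have mW := measurable_invmul_subgroup Ao.
have mA := borel_open Ao.
have mAV (y : G) : measurable ([set x | A (x^-1 * y)%g] : set (borel G)).
  apply: (borel_preimage (@invg_continuous _ _ L) (A := [set x | A (x * y)%g])).
  exact: (measurable_mulgr L).
have := indic_fubini_tonelli m m mW.
rewrite indic_fubini_tonelli_FE // indic_fubini_tonelli_GE //.
rewrite (eq_integral (fun x : borel G => (\1_K x)%:E * m A)); last first.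
  move=> x _ /=; rewrite indicE; case: (asboolP (K x)) => Kx.
    rewrite mem_set // mul1e.
    transitivity (m ([set y | A (x^-1 * y)%g] `&` K)).
      congr (m _); apply/seteqP; split=> y; rewrite /xsection /= in_setE /=.
        by move=> [].
      by move=> [].
    rewrite haar_subgroupI; last exact: (measurable_mulgl L).
    by apply: haarK.2 => //; exact: (subgroupV cK).
  rewrite memNset // mul0e -[RHS](measure0 m); congr (m _).
  by apply/seteqP; split=> y //; rewrite /xsection /= in_setE /= => -[].
rewrite integral_indic_subgroup //.
rewrite (eq_integral (fun y : borel G => (\1_K y)%:E * m [set x | A (x^-1)%g])).
  by rewrite integral_indic_subgroup.
move=> y _ /=; rewrite indicE; case: (asboolP (K y)) => Ky.
  rewrite mem_set // mul1e.
  transitivity (m ([set x | A (x^-1 * y)%g] `&` K)).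
    congr (m _); apply/seteqP; split=> x; rewrite /ysection /= in_setE /=.
      by move=> [].
    by move=> [].
  rewrite haar_subgroupI // -(haarK.2 y) //.
  by congr (m _); apply/seteqP; split=> x /=; rewrite invgM -mulgA mulVg mulg1.
rewrite memNset // mul0e -[RHS](measure0 m); congr (m _).
by apply/seteqP; split=> x //; rewrite /ysection /= in_setE /= => -[].
Qed.

Lemma measurable_invg (B : set (borel G)) : measurable B ->
  measurable ([set x | B (x^-1)%g] : set (borel G)).
Proof. by move=> mB; exact: (borel_preimage (@invg_continuous _ _ L)). Qed.

Lemma haar_inv (A : set (borel G)) : measurable A -> m [set x | A (x^-1)%g] = m A.
Proof.
apply: (@dynkin_induction _ (borel G) (@open G)
  (fun A => m [set x | A (x^-1)%g] = m A)) => //.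
- by move=> U V; exact: openI.
- by move=> U Uo; exact: haar_inv_open.
- move=> S mS hS; rewrite [RHS]probability_setC // -hS -probability_setC //.
  exact: measurable_invg.
- move=> F mF tF hF.
  rewrite [RHS]measure_semi_bigcup //; last exact: bigcup_measurable.
  rewrite -[LHS]/(m (\bigcup_n [set x | F n (x^-1)%g])).
  rewrite measure_semi_bigcup //.
  + by apply: eq_eseriesr => i _; exact: hF.
  + by move=> i; exact: measurable_invg.
  + by move=> i j _ _ [x [/= Fi Fj]]; apply: (tF i j) => //; exists (x^-1)%g.
  + by apply: bigcup_measurable => i _; exact: measurable_invg.
Qed.

(** Inversion turns left translates into right translates. *)
Lemma haar_right (k : G) (A : set (borel G)) : K k -> measurable A ->
  m [set x | A (x * k)%g] = m A.
Proof.
move=> Kk mA; rewrite -haar_inv; last exact: (measurable_mulgr L).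
have mB : measurable ([set x | A (x^-1 * k)%g] : set (borel G)).
  apply: (measurable_invg (B := [set x | A (x * k)%g])).
  exact: (measurable_mulgr L).
rewrite -[LHS](haarK.2 k _ Kk mB) -[RHS]haar_inv //.
by congr (m _); apply/seteqP; split=> x /=; rewrite invgM -mulgA mulVg mulg1.
Qed.

Lemma haar_integral_mulgl (k : G) (f : borel G -> \bar R) : K k ->
  measurable_fun setT f -> (forall x, 0 <= f x) ->
  \int[m]_x f (k * x)%g = \int[m]_x f x.
Proof.
move=> Kk mf f0.
have mk : measurable_fun setT ((fun x => (k * x)%g) : borel G -> borel G).
  exact: borel_measurable_fun (@mulgl_continuous _ _ L k).
pose km : borel G -> borel G := fun x => (k * x)%g.
transitivity (\int[pushforward m km]_x f x).
  by rewrite (ge0_integral_pushforward mk).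
by apply: eq_measure_integral => A mA _; exact: haarK.2.
Qed.

Section conv.
Variables (g : G) (M : probability (borel G) R).
Hypothesis ME : forall A, measurable A ->
  M A = \int[m]_x m [set y | A (x * g * y)%g].

Lemma conv_invl (k : G) (A : set (borel G)) : K k -> measurable A ->
  M [set z | A (k * z)%g] = M A.
Proof.
move=> Kk mA; rewrite !ME //; last exact: (measurable_mulgl L).
rewrite -[RHS](haar_integral_mulgl Kk) //; last exact: (measurable_shift_mul L).
apply: eq_integral => x _; congr (m _).
by apply/seteqP; split=> y /=; rewrite !mulgA.
Qed.

Lemma conv_invr (k : G) (A : set (borel G)) : K k -> measurable A ->
  M [set z | A (z * k)%g] = M A.
Proof.
move=> Kk mA; rewrite !ME //; last exact: (measurable_mulgr L).
apply: eq_integral => x _.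
rewrite -[RHS](haar_right Kk) //; last exact: (measurable_mulgl L).
by congr (m _); apply/seteqP; split=> y /=; rewrite !mulgA.
Qed.

Definition double_coset : set G := [set (p.1 * g * p.2)%g | p in K `*` K].

Lemma compact_double_coset : compact double_coset.
Proof. exact: (compact_mulKgK L) (subgroup_compact cK). Qed.

Lemma measurable_double_coset : measurable (double_coset : set (borel G)).
Proof.
apply: borel_closed; apply: (@compact_closed_limit _ _ L).
exact: compact_double_coset.
Qed.

Lemma conv_support (A : set (borel G)) : measurable A ->
  A `&` double_coset = set0 -> M A = 0.
Proof.
move=> mA /seteqP[AS _]; rewrite ME //.
have mK := measurable_subgroup.
have mC : m (~` K) = 0 by exact: haarK.1.
rewrite (ge0_negligible_integral _ _ _ _ mC) //; last 2 first.
- exact: measurableC.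
- exact: (measurable_shift_mul L).
apply: integral0_eq => x [_ /= /contrapT Kx].
apply/eqP; rewrite eq_le measure_ge0 andbT -mC.
apply: le_measure; rewrite ?inE; [exact: (measurable_mulgl L)|exact: measurableC|].
by move=> y /= Ay Ky; apply: (AS (x * g * y)%g); split=> //; exists (x, y).
Qed.

End conv.

End haar.

(** * Integrals against complex measures *)

Section cintegral.
Context d (T : measurableType d) (R : realType).
Local Notation C := R[i].
Local Open Scope complex_scope.
Implicit Types (M : {finite_measure set T -> \bar R}) (f : T -> C).

Definition cintegrable M f :=
  M.-integrable setT (EFin \o (@complex.Re R \o f)) /\
  M.-integrable setT (EFin \o (@complex.Im R \o f)).

Definition positive_cintegral M f : C :=
  Rintegral M setT (@complex.Re R \o f) +i* Rintegral M setT (@complex.Im R \o f).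

Lemma sum_powers_i (a b : 'I_4 -> R) (k0 := inord 0 : 'I_4) (k1 := inord 1 : 'I_4)
    (k2 := inord 2 : 'I_4) (k3 := inord 3 : 'I_4) :
  \sum_(k < 4) 'i%C ^+ k * (a k +i* b k) =
  (a k0 - b k1 - a k2 + b k3) +i* (b k0 + a k1 - b k2 - a k3).
Proof.
rewrite !big_ord_recl big_ord0 /=.
have -> : ord0 = k0 by apply: val_inj; rewrite /= inordK.
have -> : lift k0 ord0 = k1 by apply: val_inj; rewrite /= !inordK.
have -> : lift k0 (lift ord0 ord0) = k2 by apply: val_inj; rewrite /= !inordK.
have -> : lift k0 (lift ord0 (lift ord0 ord0)) = k3.
  by apply: val_inj; rewrite /= !inordK.
rewrite /bump /=.
rewrite expr0 expr1 (exprS _ 2) sqr_i.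
by apply/eqP; rewrite eq_complex /=; apply/andP; split; apply/eqP; ring.
Qed.

(** The hypothesis says that M1 is the sum of M and M2.  It is stated with real
values because the identities between positive parts of a complex measure are
read off from real and imaginary parts. *)
Lemma Rintegral_diff (M M1 M2 : {finite_measure set T -> \bar R}) (h : T -> R) :
  (forall A, measurable A -> fine (M1 A) = fine (M A) + fine (M2 A))%R ->
  M.-integrable setT (EFin \o h) -> M2.-integrable setT (EFin \o h) ->
  Rintegral M1 setT h = Rintegral M setT h + Rintegral M2 setT h.
Proof.
move=> MM hM hM2; rewrite /Rintegral -fineD; last 2 first.
- exact: (integrable_fin_num _ hM).
- exact: (integrable_fin_num _ hM2).
rewrite -(integral_measure_add measurableT hM hM2).
congr fine; apply: eq_measure_integral => A mA _.
rewrite -[LHS]fineK ?fin_num_measure // MM // EFinD !fineK ?fin_num_measure //.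
by rewrite [RHS](measure_addE M M2).
Qed.

(** The positive parts of two decompositions of the same measure differ by a
common summand, so they give the same integral. *)
Lemma has_cintegralP (M : {finite_measure set T -> \bar R}) (mu : set T -> C) f :
  (forall A, measurable A -> mu A = complex_of_measure M A) -> cintegrable M f ->
  forall z, has_cintegral mu f z <-> z = positive_cintegral M f.
Proof.
move=> muM [fr fi] z; split=> [[m [mE mf ->]]|->].
- pose k0 := inord 0 : 'I_4; pose k1 := inord 1 : 'I_4.
  pose k2 := inord 2 : 'I_4; pose k3 := inord 3 : 'I_4.
  have h A : measurable A ->
      fine (m k0 A) = (fine (M A) + fine (m k2 A))%R /\
      fine (m k1 A) = (fine (mzero A) + fine (m k3 A))%R.
    move=> mA; have := mE A mA; rewrite muM // /complex_of_measure.
    rewrite (sum_powers_i (fun k => fine (m k A)) (fun=> 0)) -/k0 -/k1 -/k2 -/k3.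
    by move=> /eqP; rewrite eq_complex /= => /andP[/eqP e1 /eqP e2]; split; lra.
  rewrite sum_powers_i -/k0 -/k1 -/k2 -/k3 /positive_cintegral.
  pose m0 : {finite_measure set T -> \bar R} := mzero.
  have zi (u : T -> R) : measurable_fun setT u ->
      m0.-integrable setT (EFin \o u).
    move=> mh; apply/integrableP; split; first exact/measurable_EFinP.
    by rewrite integral_measure_zero.
  have fz (u : T -> R) : Rintegral m0 setT u = 0.
    by rewrite /Rintegral integral_measure_zero.
  have mr : measurable_fun setT (@complex.Re R \o f).
    by apply/measurable_EFinP; case/integrableP: fr.
  have mi : measurable_fun setT (@complex.Im R \o f).
    by apply/measurable_EFinP; case/integrableP: fi.
  have h0 A mA := (h A mA).1; have h1 A mA := (h A mA).2.
  rewrite (@Rintegral_diff M (m k0) (m k2) _ h0 fr (mf k2).1).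
  rewrite (@Rintegral_diff M (m k0) (m k2) _ h0 fi (mf k2).2).
  rewrite (@Rintegral_diff m0 (m k1) (m k3) _ h1 (zi _ mr) (mf k3).1).
  rewrite (@Rintegral_diff m0 (m k1) (m k3) _ h1 (zi _ mi) (mf k3).2).
  rewrite !fz; apply/eqP; rewrite eq_complex /=.
  by apply/andP; split; apply/eqP; ring.
- pose m (k : 'I_4) : {finite_measure set T -> \bar R} :=
    if k == 0%N :> nat then M else mzero.
  have mk (k : 'I_4) : (0 < k)%N -> m k = mzero by rewrite /m; case: (k : nat).
  have m0 : m (inord 0) = M by rewrite /m inordK.
  exists m; split.
  + move=> A mA; rewrite muM // /complex_of_measure.
    rewrite (sum_powers_i (fun k => fine (m k A)) (fun=> 0)) m0 !mk ?inordK //.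
    apply/eqP; rewrite eq_complex /=.
    by apply/andP; split; apply/eqP; rewrite /= /mzero /=; ring.
  + move=> k; rewrite /m; case: ifP => // _; split; apply/integrableP; split.
    * by case/integrableP: fr.
    * by rewrite integral_measure_zero.
    * by case/integrableP: fi.
    * by rewrite integral_measure_zero.
  + rewrite sum_powers_i m0 !mk ?inordK // /Rintegral !integral_measure_zero /=.
    by rewrite !(subr0, addr0).
Qed.

Lemma cintegralE (M : {finite_measure set T -> \bar R}) (mu : set T -> C) f :
  (forall A, measurable A -> mu A = complex_of_measure M A) -> cintegrable M f ->
  cintegral mu f = positive_cintegral M f.
Proof.
move=> muM Mf; have P := has_cintegralP muM Mf.
rewrite /cintegral; case: xgetP => [z _ /P //|/(_ (positive_cintegral M f))].
by case; exact/P.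
Qed.

End cintegral.

(** * The measure of a double coset *)

Section bounded.
Context d (T : measurableType d) (R : realType).
Variable M : {finite_measure set T -> \bar R}.

Lemma bounded_integrable (h : T -> R) (b : R) : measurable_fun setT h ->
  (forall x, `|h x| <= b) -> M.-integrable setT (EFin \o h).
Proof.
move=> mh hb.
apply: le_integrable (finite_measure_integrable_cst M b measurableT) => //.
  exact/measurable_EFinP.
by move=> x _; rewrite lee_fin; apply: le_trans (hb x) _; exact: ler_norm.
Qed.

Lemma real_cintegrable (h : T -> R) (b : R) : measurable_fun setT h ->
  (forall x, `|h x| <= b) -> cintegrable M (fun x => ((h x)%:C)%C).
Proof.
move=> mh hb; split; first exact: (bounded_integrable mh hb).
by apply: (@bounded_integrable (cst 0) 0) => // x; rewrite normr0.
Qed.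

Lemma positive_cintegral_real (h : T -> R) :
  positive_cintegral M (fun x => ((h x)%:C)%C) = ((Rintegral M setT h)%:C)%C.
Proof.
rewrite /positive_cintegral; congr (_ +i* _)%C.
by rewrite /Rintegral integral0_eq.
Qed.

End bounded.

Section convolution.
Variables (R : realType) (G : preTopologicalGroupType).
Variable L : polish_direct_limit R G.
Variables (m : probability (borel G) R).
Let dK := complex_of_measure m.

Lemma xsection_mul (A : set G) (x : G) :
  xsection [set p : G * G | A (p.1 * p.2)%g] x = [set y | A (x * y)%g].
Proof. by apply/seteqP; split=> y; rewrite /xsection /= in_setE. Qed.

Lemma convolution_point (g : G) (A : set (borel G)) : measurable A ->
  convolution dK (point_mass R g) A = ((fine (m [set x | A (x * g)%g]))%:C)%C.
Proof.
move=> mA; rewrite /convolution /cproduct.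
pose Ag := [set x : borel G | A (x * g)%g].
have mAg : measurable Ag by exact: (measurable_mulgr L).
rewrite (_ : (fun x => _) = fun x : borel G => ((\1_Ag x : R)%:C)%C); last first.
  apply/funext => x; rewrite xsection_mul /point_mass /complex_of_measure /=.
  rewrite /dirac !indicE.
  by congr (_%:C)%C; congr (_%:R); apply/idP/idP; rewrite !in_setE.
rewrite (@cintegralE _ _ _ m) //; last first.
  apply: (@real_cintegrable _ _ _ _ _ 1) => [|x]; first exact: measurable_indic.
  by rewrite indicE; case: (_ \in _); rewrite ?normr1 ?normr0.
rewrite positive_cintegral_real /Rintegral; congr ((fine _)%:C)%C.
by rewrite integral_indic // setIT.
Qed.

(** The first convolution is the image of m under right translation by g, so the
second one integrates a bounded Borel function against that image. *)
Lemma convolution_double (g : G) (M : probability (borel G) R) :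
  (forall A, measurable A -> M A = \int[m]_x m [set y | A (x * g * y)%g])%E ->
  forall A, measurable A ->
  convolution (convolution dK (point_mass R g)) dK A = complex_of_measure M A.
Proof.
move=> ME A mA; rewrite {1}/convolution /cproduct.
have mg := borel_measurable_fun (@mulgr_continuous _ _ L g).
pose X : {mfun borel G >-> borel G} :=
  HB.pack (fun x : borel G => (x * g)%g : borel G)
  (isMeasurableFun.Build _ _ _ _ _ mg).
pose M1 := distribution m X.
pose h (x : borel G) := fine (m [set y | A (x * y)%g]).
have fin x : (h x)%:E = m [set y | A (x * y)%g].
  by rewrite /h fineK // fin_num_measure //; exact: (measurable_mulgl L).
have mh : measurable_fun setT h.
  apply/measurable_EFinP; rewrite (_ : _ \o _ = fun x => m [set y | A (x * y)%g]).
    exact: (measurable_shift L).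
  by apply/funext => x; exact: fin.
have h0 x : 0 <= h x by rewrite fine_ge0.
have h1 x : h x <= 1.
  by rewrite -lee_fin fin; apply: probability_le1; exact: (measurable_mulgl L).
rewrite (_ : (fun x => _) = fun x : borel G => ((h x)%:C)%C); last first.
  by apply/funext => x; rewrite xsection_mul.
rewrite (@cintegralE _ _ _ M1); last 2 first.
- by move=> B mB; rewrite convolution_point.
- by apply: (@real_cintegrable _ _ _ _ _ 1) => // x; rewrite ger0_norm.
rewrite positive_cintegral_real /Rintegral /complex_of_measure.
congr ((fine _)%:C)%C.
have mEh : measurable_fun setT (EFin \o h) by exact/measurable_EFinP.
rewrite (ge0_integral_distribution X mEh) //.
rewrite [RHS](ME A mA); apply: eq_integral => x _ /=; exact: fin.
Qed.

Variables (K : set G) (cK : compact_subgroup K) (haarK : haar_probability K m).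

Lemma convolution_hecke (g : G) :
  is_hecke K (convolution (convolution dK (point_mass R g)) dK).
Proof.
have [M ME] := conv_measure_exists L m g.
have muM := convolution_double ME.
split; first split.
- exists (charge_of_finite_measure M), (@czero _ (borel G) R) => A mA.
  by rewrite muM.
- exists (double_coset K g); first exact: (compact_double_coset L cK).
  move=> A mA AS; rewrite muM // -[RHS]/((fine (0%:E : \bar R))%:C)%C.
  by congr ((fine _)%:C)%C; exact: (conv_support L cK haarK ME).
- move=> k A Kk mA; split; rewrite !muM //.
  + by congr ((fine _)%:C)%C; exact: (conv_invl L haarK ME).
  + exact: (measurable_mulgl L).
  + by congr ((fine _)%:C)%C; exact: (conv_invr L cK haarK ME).
  + exact: (measurable_mulgr L).
Qed.

End convolution.

(** * Operators of double cosets on the fixed vectors *)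

Section coefficients.
Variables (R : realType) (G : preTopologicalGroupType) (H : hilbertType R).
Variable rho : unitary_rep G H.
Implicit Types (v w u : H) (x g k : G).

Lemma rep_adjoint x v w : inner (rho x v) w = inner v (rho (x^-1)%g w).
Proof. by rewrite -(rep_unitary rho x v) -repM mulgV rep1. Qed.

Lemma rrep_adjoint x v w : rinner (rho x v) w = rinner v (rho (x^-1)%g w).
Proof. by rewrite /rinner rep_adjoint. Qed.

Lemma coef_bounded x v w : `|rinner (rho x v) w| <= rnorm v * rnorm w.
Proof.
rewrite -[rnorm v](_ : rnorm (rho x v) = _) ?rinner_CauchySchwarz //.
by rewrite /rnorm /rinner rep_unitary.
Qed.

Lemma coef_continuous v w : continuous (fun x : G => rinner (rho x v) w).
Proof.
move=> x; apply/cvgrPdist_lt => e e0.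
have w0 := rnorm_ge0 w.
have d0 : 0 < e / (rnorm w + 1) by rewrite divr_gt0 //; lra.
have /cvgrPdist_lt/(_ ((e / (rnorm w + 1))%:C)%C) := @rep_continuous _ _ _ rho v x.
rewrite ltcR => /(_ d0); apply: filterS => y.
rewrite normr_rnorm ltcR ltr_pdivlMr; last by lra.
move=> h; rewrite -[X in _ - X]opprK opprK -rinnerNl -rinnerDl.
apply: le_lt_trans (rinner_CauchySchwarz _ _) _; apply: le_lt_trans h.
by rewrite ler_wpM2l ?rnorm_ge0 // lerDl.
Qed.

Variable M : probability (borel G) R.

Lemma coef_integrable v w :
  M.-integrable setT (EFin \o (fun x : borel G => rinner (rho x v) w)).
Proof.
apply: (@bounded_integrable _ _ _ M _ (rnorm v * rnorm w)) => [|x]; last first.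
  exact: coef_bounded.
by apply: borel_measurable_real; exact: coef_continuous.
Qed.

Lemma Im_coef v w : @complex.Im R \o (fun x : G => inner (rho x v) w) =
  fun x => rinner (rho x v) ('i%C *: w).
Proof. by apply/funext => x /=; rewrite Im_inner. Qed.

Lemma coef_cintegrable v w : cintegrable M (fun x : borel G => inner (rho x v) w).
Proof. by split; [|rewrite Im_coef]; exact: coef_integrable. Qed.

(** The integral is a bounded functional of w, represented by a vector.  Applying
the real Riesz theorem to the real part is enough, since the imaginary part is
the value at i w. *)
Lemma weak_integral_exists v : exists u, forall w,
  inner u w = positive_cintegral M (fun x : borel G => inner (rho x v) w).
Proof.
pose psi w := Rintegral M setT (fun x : borel G => rinner (rho x v) w).
have [||| u hu] := @real_riesz R H psi (rnorm v).
- move=> w1 w2; rewrite /psi -RintegralD //; try exact: coef_integrable.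
  by apply: eq_Rintegral => x _; rewrite rinnerDr.
- move=> c w; rewrite /psi -RintegralZl //; last exact: coef_integrable.
  by apply: eq_Rintegral => x _; rewrite rinnerZr.
- move=> w; apply: le_trans (le_normr_Rintegral _ _) _ => //.
    exact: coef_integrable.
  have -> : rnorm v * rnorm w = Rintegral M setT (fun=> rnorm v * rnorm w).
    rewrite Rintegral_cst // -[LHS]mulr1; congr (_ * _).
    exact: esym (congr1 fine (probability_setT M)).
  apply: le_Rintegral => //.
  + have -> : EFin \o (fun x : borel G => `|rinner (rho x v) w|) =
      (abse \o (EFin \o (fun x : borel G => rinner (rho x v) w))) by [].
    by apply: integrable_abse; exact: coef_integrable.
  + exact: finite_measure_integrable_cst.
  + by move=> x _; exact: coef_bounded.
exists u => w; apply/eqP; rewrite eq_complex /= Im_inner Im_coef.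
by apply/andP; split; apply/eqP; rewrite ?hu //; exact: hu.
Qed.

Lemma rep_measureE (mu : set (borel G) -> R[i]) v :
  (forall A, measurable A -> mu A = complex_of_measure M A) -> forall w,
  inner (rep_measure rho mu v) w =
  positive_cintegral M (fun x : borel G => inner (rho x v) w).
Proof.
move=> muM w; have P w' := has_cintegralP muM (coef_cintegrable v w').
rewrite /rep_measure; case: xgetP => [u _ hu|none]; first exact/P/hu.
have [u hu] := weak_integral_exists v.
by case: (none u) => w'; apply/P; exact: hu.
Qed.

End coefficients.

Section kernel.
Variables (R : realType) (G : preTopologicalGroupType).
Variable L : polish_direct_limit R G.
Variables (K : set G) (cK : compact_subgroup K).
Variables (m : probability (borel G) R) (haarK : haar_probability K m).
Variables (H : hilbertType R) (rho : unitary_rep G H).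
Local Notation V := (fixed rho K).

Lemma fixed_valE (v : V) k : K k -> rho k (fixed_val v) = fixed_val v.
Proof. by move=> Kk; have /asboolP := fixed_valP v; exact. Qed.

Variables (g : G) (M : probability (borel G) R).
Hypothesis ME : (forall A, measurable A ->
  M A = \int[m]_x m [set y | A (x * g * y)%g])%E.

Lemma coef_integral_mulgl (v w : H) (k : G) : K k ->
  Rintegral M setT (fun x : borel G => rinner (rho (k * x)%g v) w) =
  Rintegral M setT (fun x : borel G => rinner (rho x v) w).
Proof.
move=> Kk; have mk := borel_measurable_fun (@mulgl_continuous _ _ L k).
pose f (x : borel G) := (rinner (rho x v) w)%:E.
have mf : measurable_fun setT f.
  by have /integrableP[] := coef_integrable rho M v w.
rewrite /Rintegral; congr fine.
pose km : borel G -> borel G := fun x => (k * x)%g.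
transitivity (\int[pushforward M km]_x f x)%E; last first.
  by apply: eq_measure_integral => A mA _; exact: (conv_invl L haarK ME).
rewrite (integral_pushforward mk) //.
rewrite preimage_setT.
rewrite (_ : f \o _ = fun x : borel G => (rinner (rho x v) (rho k^-1%g w))%:E).
  exact: coef_integrable.
by apply/funext => x; rewrite /f /= repM rrep_adjoint.
Qed.

(** The coefficient is constant on the double coset K g K, which has full
measure. *)
Lemma coef_integral_fixed (v w : H) :
  (forall k, K k -> rho k v = v) -> (forall k, K k -> rho k w = w) ->
  Rintegral M setT (fun x : borel G => rinner (rho x v) w) = rinner (rho g v) w.
Proof.
move=> fv fw; set c := RHS.
have mS := measurable_double_coset L cK g.
have MS : M (~` double_coset K g) = 0%E.
  apply: (conv_support L cK haarK ME); first exact: measurableC.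
  by rewrite setICl.
have -> : c = Rintegral M setT (fun=> c).
  rewrite Rintegral_cst // -[LHS]mulr1; congr (_ * _).
  exact: esym (congr1 fine (probability_setT M)).
rewrite /Rintegral; congr fine.
have mC : measurable (~` double_coset K g : set (borel G)) by exact: measurableC.
rewrite (negligible_integral mC measurableT (coef_integrable rho M v w) MS).
have ic := finite_measure_integrable_cst M c measurableT.
rewrite [RHS](negligible_integral mC measurableT ic MS).
apply: eq_integral => x; rewrite inE => -[_ /= /contrapT [[a b] /= [Ka Kb] <-]].
by rewrite /= !repM fv // rrep_adjoint fw //; exact: subgroupV.
Qed.

Local Notation mu := (convolution
  (convolution (complex_of_measure m) (point_mass R g)) (complex_of_measure m)).

(** Left invariance of the measure under K. *)
Lemma rep_convolution_fixed (v : V) :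
  rep_measure rho mu (fixed_val v) \in fixed_pred rho K.
Proof.
have muM := convolution_double L ME.
have uE w : rinner (rep_measure rho mu (fixed_val v)) w =
    Rintegral M setT (fun x : borel G => rinner (rho x (fixed_val v)) w).
  by rewrite /rinner (rep_measureE rho (fixed_val v) muM).
apply/asboolP => k Kk; apply: inner_ext => w.
rewrite rrep_adjoint !uE -[RHS](coef_integral_mulgl _ _ Kk).
by apply: eq_Rintegral => x _; rewrite /= repM [RHS]rrep_adjoint.
Qed.

Lemma rep_convolution_inner (v w : V) :
  inner (rep_measure rho mu (fixed_val v)) (fixed_val w) =
  inner (rho g (fixed_val v)) (fixed_val w).
Proof.
have muM := convolution_double L ME.
rewrite (rep_measureE rho (fixed_val v) muM) /positive_cintegral Im_coef.
have iw k : K k -> rho k ('i%C *: fixed_val w) = 'i%C *: fixed_val w.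
  by move=> Kk; rewrite linearZ fixed_valE.
apply/eqP; rewrite eq_complex /= Im_inner.
apply/andP; split; apply/eqP.
  by apply: coef_integral_fixed => k Kk; rewrite fixed_valE.
by apply: coef_integral_fixed => k Kk; rewrite ?fixed_valE ?iw.
Qed.

End kernel.

Section kernel_value.
Variables (R : realType) (G : preTopologicalGroupType).
Variable L : polish_direct_limit R G.
Variables (K : set G) (cK : compact_subgroup K).
Variables (m : probability (borel G) R) (haarK : haar_probability K m).
Variables (H : hilbertType R) (rho : unitary_rep G H).
Local Notation V := (fixed rho K).

(** The operator is that of g = h_b h_a^-1 between K-fixed vectors, and unitarity
of rho(h_b) splits its coefficients into a Gram kernel. *)
Lemma rep_kernelE (a b : coset_space K) (v w : V) :
  inner (rep_kernel m (@Res R G H rho K) a b v) w =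
  inner (rho ((coset_repr a)^-1)%g (fixed_val v))
        (rho ((coset_repr b)^-1)%g (fixed_val w)).
Proof.
rewrite /rep_kernel /Res; set g := (_ * _)%g.
have [M ME] := conv_measure_exists L m g.
rewrite -[LHS]/(inner (fixed_val _) (fixed_val w)).
rewrite insubdK; last first.
  rewrite insubdK; first exact: (rep_convolution_fixed L haarK ME).
  by apply/asboolP; exact: (convolution_hecke L cK haarK).
rewrite insubdK; last by apply/asboolP; exact: (convolution_hecke L cK haarK).
rewrite (rep_convolution_inner L cK haarK ME) /g repM.
by rewrite rep_adjoint.
Qed.

End kernel_value.

(** * The synthesis map *)

Section pullback.
Variables (R : realType) (D : lmodType R[i]) (V : innerType R).
Variable T : {linear D -> V}.

Definition pullback_form (u v : D) : R[i] := inner (T u) (T v).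

Let pullback_bil :
  bilinear_for ( *%R ) (Num.conj \; *%R : GRing.Scale.law R[i] R[i]) pullback_form.
Proof.
split=> w c u v; rewrite /pullback_form linearP.
  by rewrite innerDl innerZl.
by rewrite innerDr innerZr.
Qed.
HB.instance Definition _ := bilinear_isBilinear.Build R[i] D D R[i]
  ( *%R ) (Num.conj \; *%R) pullback_form pullback_bil.
Let pullback_herm u v :
  pullback_form u v = (-1) ^+ false * Num.conj (pullback_form v u).
Proof. by rewrite expr0 mul1r /pullback_form innerC. Qed.
HB.instance Definition _ := isHermitianSesquilinear.Build R[i] D false
  Num.conj pullback_form pullback_herm.

Definition pullback_nonneg : nonneg_form D :=
  NonnegForm (form_of := pullback_form) (fun u => inner_ge0 (T u)).

End pullback.

Section inner_sum.
Variables (R : realType) (V : innerType R).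

Lemma inner_suml (I : Type) (r : seq I) (F : I -> V) (w : V) :
  inner (\sum_(i <- r) F i) w = \sum_(i <- r) inner (F i) w.
Proof.
apply: (big_morph (fun u => inner u w)) => [u v|]; first exact: innerDl.
exact: inner0l.
Qed.

Lemma inner_sumr (I : Type) (r : seq I) (F : I -> V) (w : V) :
  inner w (\sum_(i <- r) F i) = \sum_(i <- r) inner w (F i).
Proof.
by apply: (big_morph (inner w)) => [u v|]; [exact: innerDr|exact: inner0r].
Qed.

End inner_sum.

Section cosets.
Variables (G : preTopologicalGroupType) (K : set G) (cK : compact_subgroup K).

Lemma coset_mem (x : coset_space K) (g : G) :
  coset_set x g -> exists2 k, K k & g = (k * coset_repr x)%g.
Proof.
rewrite /coset_repr; case: cid => h /= -> [k Kk <-]; by exists k.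
Qed.

Lemma coset_repr_mem (x : coset_space K) : coset_set x (coset_repr x).
Proof.
rewrite /coset_repr; case: cid => h /= ->.
by exists 1%g; [exact: subgroup1 cK|rewrite mul1g].
Qed.

Definition coset_through (g : G) : coset_space K :=
  @CosetSpace _ K [set (k * g)%g | k in K] (ex_intro _ g erefl).

Lemma coset_repr_coset (g : G) :
  exists2 k, K k & coset_repr (coset_through g) = (k * g)%g.
Proof. by have [k Kk <-] := coset_repr_mem (coset_through g); exists k. Qed.

Lemma coset_repr_shift (x : coset_space K) (r : G) :
  exists2 k, K k & coset_repr (coset_shift x r) = (k * (coset_repr x * r))%g.
Proof.
have [y /coset_mem[k Kk ->] <-] := coset_repr_mem (coset_shift x r).
by exists k; rewrite ?mulgA.
Qed.

Lemma coset_space_eq (x y : coset_space K) : coset_set x = coset_set y -> x = y.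
Proof.
case: x y => [A hA] [B hB] /= AB; rewrite AB in hA *.
by congr CosetSpace; exact: Prop_irrelevance.
Qed.

Lemma coset_shiftM (x : coset_space K) (r s : G) :
  coset_shift (coset_shift x r) s = coset_shift x (r * s)%g.
Proof.
apply: coset_space_eq; apply/seteqP; split=> z /=.
  by move=> [_ [y xy <-] <-]; exists y; rewrite ?mulgA.
by move=> [y xy <-]; exists (y * r)%g; rewrite ?mulgA //; exists y.
Qed.

Lemma coset_shift1 (x : coset_space K) : coset_shift x 1%g = x.
Proof.
apply: coset_space_eq; apply/seteqP; split=> z /=.
  by move=> [y xy <-]; rewrite mulg1.
by move=> xz; exists z; rewrite ?mulg1.
Qed.

Lemma coset_shift_bij (r : G) :
  bijective (fun x : coset_space K => coset_shift x r).
Proof.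
by exists (fun x => coset_shift x (r^-1)%g) => x;
  rewrite coset_shiftM ?mulgV ?mulVg coset_shift1.
Qed.

End cosets.

Section synthesis.
Variables (R : realType) (G : preTopologicalGroupType).
Variables (K : set G) (cK : compact_subgroup K).
Variables (H : hilbertType R) (rho : unitary_rep G H).
Local Notation V := (fixed rho K).
Implicit Types (f g : Delta K V) (a : coset_space K) (v : V).

Definition coset_vec a v : H := rho ((coset_repr a)^-1)%g (fixed_val v).

Fact coset_vec_is_linear a : linear (coset_vec a).
Proof. by move=> c u v; rewrite /coset_vec -linearP. Qed.
HB.instance Definition _ a := GRing.isLinear.Build R[i] V H *:%R (coset_vec a)
  (coset_vec_is_linear a).

(** The vector of H that the finitely supported function f stands for. *)
Definition synthesis f : H := \sum_(a \in [set: coset_space K]) coset_vec a (f a).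

Lemma Delta_supp_finite f : finite_set (Delta_supp f).
Proof. by have /asboolP := Delta_valP f. Qed.

Lemma synthesisE f (s : seq (coset_space K)) : uniq s ->
  (forall a, a \notin s -> f a = 0) ->
  synthesis f = \sum_(a <- s) coset_vec a (f a).
Proof.
move=> us fs; rewrite fsbig_seq //; apply/esym/fsbig_widen => // a [_ /= /negP sa].
by rewrite /= fs // linear0.
Qed.

Lemma Delta_support f :
  exists s : seq (coset_space K), uniq s /\ Delta_supp f = [set` s].
Proof.
have /finite_seqP[s fs] := Delta_supp_finite f; exists (undup s); split.
  exact: undup_uniq.
by rewrite fs; apply/seteqP; split=> a /=; rewrite mem_undup.
Qed.

Lemma notin_support f (s : seq (coset_space K)) :
  Delta_supp f = [set` s] -> forall a, a \notin s -> f a = 0.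
Proof.
move=> fs a /negP sa; apply/eqP; apply: contrapT => /negP fa; apply: sa.
have : Delta_supp f a by [].
by rewrite fs.
Qed.

Lemma synthesis_is_linear : linear synthesis.
Proof.
move=> c f g.
have [s [us fs]] := Delta_support f; have [t [ut gt]] := Delta_support g.
pose X := undup (s ++ t).
have uX : uniq X by exact: undup_uniq.
have fX a : a \notin X -> f a = 0.
  by rewrite mem_undup mem_cat negb_or => /andP[sa _]; exact: (notin_support fs).
have gX a : a \notin X -> g a = 0.
  by rewrite mem_undup mem_cat negb_or => /andP[_ ta]; exact: (notin_support gt).
rewrite (synthesisE uX fX) (synthesisE uX gX) (@synthesisE _ X) //; last first.
  by move=> a aX; rewrite -[LHS]/(c *: f a + g a) fX // gX // scaler0 add0r.
rewrite scaler_sumr -big_split /=; apply: eq_bigr => a _.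
by rewrite -[X in coset_vec a X]/(c *: f a + g a) linearP.
Qed.
HB.instance Definition _ := GRing.isLinear.Build R[i] (Delta K V) H *:%R synthesis
  synthesis_is_linear.

(** The representative of the coset a r is k h_a r with k in K, and k^-1 fixes the
values of f. *)
Lemma synthesis_shift r f : synthesis (Delta_shift r f) = rho r (synthesis f).
Proof.
have [s [us fs]] := Delta_support f.
have -> : rho r (synthesis f) =
    \sum_(a \in [set: coset_space K]) rho r (coset_vec a (f a)).
  rewrite (synthesisE us (notin_support fs)) linear_sum fsbig_seq //.
  apply: fsbig_widen => // a [_ /= /negP sa].
  by rewrite /= (notin_support fs sa) !linear0.
rewrite (reindex_fsbigT (fun a : coset_space K => coset_shift a r)); last first.
  exact: coset_shift_bij.
apply: eq_fsbigr => a _; rewrite /= /coset_vec.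
have [k Kk ->] := coset_repr_shift cK a r.
rewrite -[RHS]repM !invgM !mulgA mulgV mul1g repM.
by rewrite (fixed_valE _ (subgroupV cK Kk)).
Qed.

Fact single_subproof a v :
  (fun x => if x == a then v else 0) \in @finsupp_pred R G K V.
Proof.
apply/asboolP; apply: (sub_finite_set _ (finite_set1 a)) => x /=.
by case: (x =P a) => // _; rewrite eqxx.
Qed.
Definition single a v : Delta K V := DeltaFun (single_subproof a v).

Lemma synthesis_single a v : synthesis (single a v) = coset_vec a v.
Proof.
rewrite (@synthesisE _ [:: a]) ?big_seq1 /= ?eqxx //.
by move=> x; rewrite inE => /negbTE ->.
Qed.

Lemma inner_synthesisr u f :
  inner u (synthesis f) = \sum_(a \in Delta_supp f) inner u (coset_vec a (f a)).
Proof.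
have [s [us fs]] := Delta_support f.
by rewrite (synthesisE us (notin_support fs)) inner_sumr fs fsbig_seq.
Qed.

Lemma inner_synthesisl u f :
  inner (synthesis f) u = \sum_(a \in Delta_supp f) inner (coset_vec a (f a)) u.
Proof.
have [s [us fs]] := Delta_support f.
by rewrite (synthesisE us (notin_support fs)) inner_suml fs fsbig_seq.
Qed.

(** rho(g) eta is the image of eta placed at the coset of g^-1. *)
Lemma synthesis_dense : cyclic_fixed rho K -> dense (range synthesis).
Proof.
move=> cyc O O0 Oo; have [x [Ox [n [c [g [eta xE]]]]]] := cyc O O0 Oo.
exists x; split=> //.
exists (\sum_(i < n) c i *: single (coset_through K (g i)^-1%g) (eta i)) => //.
rewrite xE linear_sum; apply: eq_bigr => i _.
rewrite linearZ /= synthesis_single /coset_vec.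
have [k Kk ->] := coset_repr_coset cK (g i)^-1%g.
by rewrite invgM invgK repM fixed_valE //; exact: (subgroupV cK).
Qed.

End synthesis.

Theorem proposition2p2 (R : realType) (G : preTopologicalGroupType)
    (limG : polish_direct_limit R G)
    (K : set G) (cK : compact_subgroup K)
    (deltaK : probability (borel G) R) (haarK : haar_probability K deltaK)
    (H : hilbertType R) (sepH : separable_space H)
    (rho : unitary_rep G H) (cycK : cyclic_fixed rho K) :
  let V : innerType R := fixed rho K in
  let tau : hecke R K -> V -> V := @Res R G H rho K in
  (forall (n : nat) (v : 'I_n -> V) (a : 'I_n -> coset_space K),
     0 <= \sum_(i < n) \sum_(j < n) inner (rep_kernel deltaK tau (a i) (a j) (v i)) (v j)) /\
  exists (B : nonneg_form (Delta K V)),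
    (forall f1 f2, B f1 f2 = Delta_form deltaK tau f1 f2) /\
    exists sigma : unitary_rep G (hilbert_completion B),
      (forall (r : G) (f : Delta K V),
         sigma r (completion_embed B f) = completion_embed B (Delta_shift r f)) /\
      unitary_equivalent sigma rho.
Proof.
move=> V tau.
have kernelE a b (v w : V) :
    inner (rep_kernel deltaK tau a b v) w = inner (coset_vec a v) (coset_vec b w).
  exact: (rep_kernelE limG).
split=> [n v a|].
  apply: le_trans (inner_ge0 (\sum_(i < n) coset_vec (a i) (v i))) _.
  rewrite inner_suml le_eqVlt; apply/orP; left; apply/eqP.
  apply: eq_bigr => i _; rewrite inner_sumr.
  by apply: eq_bigr => j _; rewrite kernelE.
pose T : {linear Delta K V -> H} := @synthesis R G K H rho.
exists (pullback_nonneg T); split=> [f1 f2|].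
  rewrite -[LHS]/(inner (synthesis f1) (synthesis f2)) /Delta_form.
  rewrite inner_synthesisl; apply: eq_fsbigr => a _.
  by rewrite inner_synthesisr; apply: eq_fsbigr => b _; rewrite kernelE.
have [U [Ubij Uinner UT]] := @completion_extension R _ (pullback_nonneg T) H T
  (fun _ _ => erefl) (synthesis_dense cK cycK).
have [sigma UsE] := transport_rep rho Ubij Uinner.
exists sigma; split; last by exists U.
move=> r f; apply: (bij_inj Ubij).
by rewrite UsE !UT; exact/esym/synthesis_shift.
Qed.
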